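(* Let $G$ be a commutative group, let $h\colon R\to S$ be a morphism of $G$-graded commutative rings, let $L$ be a $G$-graded $S$-module, and let $M$ and $N$ be $G$-graded $R$-modules. Let $$\nu^h_{L,M,N}\colon\mathrm{Hom}^G_R(L,M)\otimes_RN\to\mathrm{Hom}^G_R(L,M\otimes_RN),\quad u\otimes x\mapsto(y\mapsto u(y)\otimes x)$$ be the canonical morphism in $\mathrm{Mod}^G(S)$. If $N$ is projective, then $\nu^h_{L,M,N}$ is a monomorphism. If $h_*(L)$ is projective and of finite type, or if $N$ is projective and of finite type, or if $h_*(L)$ is small and $N$ is projective, then $\nu^h_{L,M,N}$ is an isomorphism.
   Context: All groups and rings are commutative (rings unital). $\mathrm{Mod}^G(R)$ is the category of $G$-graded $R$-modules with degree-preserving $R$-linear maps; $M(g)$ is the shift, $M(g)_{g'}=M_{g+g'}$. The tensor product $M\otimes_RN$ is graded with $x\otimes y$ in degree $\deg x+\deg y$. For $G$-graded $R$-modules, $\mathrm{Hom}^G_R(M,N)=\bigoplus_{g\in G}\mathrm{Hom}_{\mathrm{Mod}^G(R)}(M,N(g))$, a $G$-graded $R$-module. $h_*\colon\mathrm{Mod}^G(S)\to\mathrm{Mod}^G(R)$ is restriction of scalars along $h$. For a $G$-graded $S$-module $L$ and a $G$-graded $R$-module $M$, $\mathrm{Hom}^G_R(L,M)$ denotes $\mathrm{Hom}^G_R(h_*(L),M)$ with the $S$-action $(su)(y)=u(sy)$. For a $G$-graded $S$-module $P$ and a $G$-graded $R$-module $N$, $P\otimes_RN$ denotes $h_*(P)\otimes_RN$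 with the $S$-action $s(p\otimes x)=(sp)\otimes x$. A $G$-graded $R$-module $M$ is: of finite type if there is an epimorphism $F\to M$ in $\mathrm{Mod}^G(R)$ with $F\cong\bigoplus_{i\in I}R(g_i)$ for a finite family $(g_i)_{i\in I}$ in $G$; projective if $\mathrm{Hom}_{\mathrm{Mod}^G(R)}(M,\bullet)$ is exact; small if for every family $(N_j)_{j\in J}$ of $G$-graded $R$-modules the canonical map $\bigoplus_j\mathrm{Hom}_{\mathrm{Mod}^G(R)}(M,N_j)\to\mathrm{Hom}_{\mathrm{Mod}^G(R)}(M,\bigoplus_jN_j)$ is an isomorphism. *)

(* Defs.v *)
From HB Require Import structures.
From mathcomp Require Import all_boot all_algebra.
From mathcomp Require Import mathcomp_extra boolp classical_sets functions.
From mathcomp Require Import cardinality fsbigop.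
From mathcomp Require Import freeg.

Set Implicit Arguments.
Unset Strict Implicit.
Unset Printing Implicit Defensive.

Import GRing.Theory.

Local Open Scope classical_set_scope.
Local Open Scope ring_scope.

Section FiniteSums.
Variables (I : choiceType) (V : zmodType).
Implicit Types (F H : I -> V) (s : seq I).

Lemma fsumE F s : uniq s -> (forall i, F i != 0 -> i \in s) ->
  \sum_(i \in [set: I]) F i = \sum_(i <- s) F i.
Proof.
move=> us Fs; rewrite (fsbigE s) //=; last first.
  by move=> i _; apply: contraNeq => /Fs.
by under eq_bigl do rewrite in_setT.
Qed.

Lemma finsupp_seq F : finite_set [set i | F i != 0] ->
  exists2 s : seq I, uniq s & forall i, F i != 0 -> i \in s.
Proof.
move=> /finite_seqP [s sE]; exists (undup s); first exact: undup_uniq.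
by move=> i Fi; rewrite mem_undup; have : [set` s] i by rewrite -sE.
Qed.

Lemma seq_finsupp F s : (forall i, F i != 0 -> i \in s) ->
  finite_set [set i | F i != 0].
Proof. by move=> Fs; apply: sub_finite_set (finite_seq s) => i /= /Fs. Qed.

Lemma fsum_single F k : (forall i, i != k -> F i = 0) ->
  \sum_(i \in [set: I]) F i = F k.
Proof.
move=> Fk; rewrite (@fsumE _ [:: k]) ?big_seq1 // => i.
by rewrite inE; apply: contraNT => /Fk ->.
Qed.

Lemma fsumD F H :
    finite_set [set i | F i != 0] -> finite_set [set i | H i != 0] ->
  \sum_(i \in [set: I]) (F i + H i) =
  \sum_(i \in [set: I]) F i + \sum_(i \in [set: I]) H i.
Proof.
move=> /finsupp_seq [s1 _ s1P] /finsupp_seq [s2 _ s2P].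
pose s := undup (s1 ++ s2); have us : uniq s by apply: undup_uniq.
have sP i : (i \in s) = (i \in s1) || (i \in s2).
  by rewrite mem_undup mem_cat.
rewrite !(@fsumE _ s) ?big_split // => i; rewrite sP.
- by move=> /s2P ->; rewrite orbT.
- by move=> /s1P ->.
case: (eqVneq (F i) 0) => [->|/s1P -> //].
by rewrite add0r => /s2P ->; rewrite orbT.
Qed.

End FiniteSums.

Lemma fsum_raddf (I : choiceType) (V W : zmodType) (f : {additive V -> W})
    (F : I -> V) : finite_set [set i | F i != 0] ->
  f (\sum_(i \in [set: I]) F i) = \sum_(i \in [set: I]) f (F i).
Proof.
move=> /finsupp_seq [s us sP]; rewrite !(@fsumE _ _ _ s) ?raddf_sum // => i.
by move=> fi; apply: sP; apply: contraNneq fi => ->; rewrite raddf0.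
Qed.

Section DirectProduct.
Variable J : Type.

Definition dprod (N : J -> zmodType) : Type := forall j, N j.
HB.instance Definition _ (N : J -> zmodType) := Choice.on (dprod N).

Section Zmod.
Variable N : J -> zmodType.
Definition dprod_zero : dprod N := fun=> 0.
Definition dprod_opp (f : dprod N) : dprod N := fun j => - f j.
Definition dprod_add (f g : dprod N) : dprod N := fun j => f j + g j.

Fact dprod_addA : associative dprod_add.
Proof. by move=> f g k; apply: functional_extensionality_dep => j; exact: addrA. Qed.
Fact dprod_addC : commutative dprod_add.
Proof. by move=> f g; apply: functional_extensionality_dep => j; exact: addrC. Qed.
Fact dprod_add0 : left_id dprod_zero dprod_add.
Proof. by move=> f; apply: functional_extensionality_dep => j; exact: add0r. Qed.
Fact dprod_addN : left_inverse dprod_zero dprod_opp dprod_add.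
Proof. by move=> f; apply: functional_extensionality_dep => j; exact: addNr. Qed.

HB.instance Definition _ := GRing.isZmodule.Build (dprod N)
  dprod_addA dprod_addC dprod_add0 dprod_addN.

Definition finsupp : {pred dprod N} :=
  fun f => `[< finite_set [set j | f j != 0] >].

Fact finsupp_zmod_closed : zmod_closed finsupp.
Proof.
split=> [|f g /asboolP ff /asboolP gf]; apply/asboolP.
  by rewrite (_ : [set _ | _] = set0) // -subset0 => j /=; rewrite eqxx.
have : finite_set ([set j | f j != 0] `|` [set j | g j != 0]).
  by rewrite finite_setU.
apply: sub_finite_set => j /=; have -> : (f - g) j = f j - g j by [].
case: (eqVneq (f j) 0) => [->|]; last by left.
by rewrite sub0r oppr_eq0; right.
Qed.
HB.instance Definition _ :=
  GRing.isZmodClosed.Build (dprod N) finsupp finsupp_zmod_closed.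

Record dsum : Type := DSum { dsum_val : dprod N; _ : dsum_val \in finsupp }.
HB.instance Definition _ := [isSub for dsum_val].
HB.instance Definition _ := [Choice of dsum by <:].
HB.instance Definition _ := [SubChoice_isSubZmodule of dsum by <:].

Definition dsum_fun (u : dsum) : forall j, N j := dsum_val u.
Coercion dsum_fun : dsum >-> Funclass.

Lemma dsumP (u v : dsum) : (forall j, u j = v j) -> u = v.
Proof. by move=> uv; apply/val_inj/functional_extensionality_dep. Qed.

Lemma dsum_fin (u : dsum) : finite_set [set j | u j != 0].
Proof. by case: u => u /= /asboolP. Qed.

Lemma dsum0E j : (0 : dsum) j = 0. Proof. by []. Qed.
Lemma dsumDE (u v : dsum) j : (u + v) j = u j + v j. Proof. by []. Qed.
Lemma dsumNE (u : dsum) j : (- u) j = - u j. Proof. by []. Qed.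

End Zmod.

Section Lmod.
Variables (R : pzRingType) (N : J -> lmodType R).

Definition lsum : Type := dsum (fun j => N j).
HB.instance Definition _ := GRing.Zmodule.on lsum.

Fact lsum_scale_subproof (r : R) (u : lsum) :
  ((fun j => r *: u j) : dprod (fun j => N j)) \in finsupp (N := fun j => N j).
Proof.
apply/asboolP; apply: sub_finite_set (dsum_fin u) => j /=.
by apply: contraNneq => ->; rewrite scaler0.
Qed.
Definition lsum_scale (r : R) (u : lsum) : lsum :=
  DSum (lsum_scale_subproof r u).

Fact lsum_scaleA a b u : lsum_scale a (lsum_scale b u) = lsum_scale (a * b) u.
Proof. by apply: dsumP => j; exact: scalerA. Qed.
Fact lsum_scale1 : left_id 1 lsum_scale.
Proof. by move=> u; apply: dsumP => j; exact: scale1r. Qed.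
Fact lsum_scaleDr : right_distributive lsum_scale +%R.
Proof. by move=> r u v; apply: dsumP => j; exact: scalerDr. Qed.
Fact lsum_scaleDl u : {morph lsum_scale^~ u : a b / a + b}.
Proof. by move=> a b; apply: dsumP => j; exact: scalerDl. Qed.

HB.instance Definition _ := GRing.Zmodule_isLmodule.Build R lsum
  lsum_scaleA lsum_scale1 lsum_scaleDr lsum_scaleDl.

End Lmod.
End DirectProduct.

Arguments dsumP {J N}.
Arguments dsum_fun : simpl never.

(* [is_grading c] : the abelian group [V] is the internal direct sum of its
   subgroups [c g], for [g] in [G]. *)
Record is_grading (G V : zmodType) (c : G -> set V) : Prop := IsGrading {
  grading0 : forall g, c g 0;
  gradingB : forall g x y, c g x -> c g y -> c g (x - y);
  grading_ex : forall x, exists F : G -> V,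
    [/\ finite_set [set g | F g != 0], forall g, c g (F g)
      & x = \sum_(g \in [set: G]) F g];
  grading_uniq : forall F : G -> V,
    finite_set [set g | F g != 0] -> (forall g, c g (F g)) ->
    \sum_(g \in [set: G]) F g = 0 -> forall g, F g = 0
}.

Section GradingTheory.
Variables (G V : zmodType) (c : G -> set V).

Lemma is_grading_proj (p : G -> V -> V) :
    (forall g, c g 0) ->
    (forall g x y, c g x -> c g y -> c g (x - y)) ->
    (forall x, exists F : G -> V,
      [/\ finite_set [set g | F g != 0], forall g, c g (F g)
        & x = \sum_(g \in [set: G]) F g]) ->
    (forall g x y, p g (x - y) = p g x - p g y) ->
    (forall g x, c g x -> p g x = x) ->
    (forall g k x, k != g -> c k x -> p g x = 0) ->
  is_grading c.
Proof.
move=> c0 cB cex pB pid p0; split=> // F Ffin cF F0 g.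
pose p_ := GRing.isZmodMorphism.Build _ _ (p g) (pB g).
pose pg : {additive V -> V} := HB.pack (p g) p_.
have /esym := fsum_raddf pg Ffin; rewrite F0 raddf0 (@fsum_single _ _ _ g) /=.
  by rewrite pid.
by move=> i /p0 -> //; exact: cF.
Qed.

Hypothesis cP : is_grading c.

Lemma gradingN g x : c g x -> c g (- x).
Proof. by move=> cx; rewrite -sub0r; apply: gradingB => //; apply: grading0. Qed.

Lemma gradingD g x y : c g x -> c g y -> c g (x + y).
Proof.
by move=> cx cy; rewrite -[y]opprK; apply: gradingB => //; apply: gradingN.
Qed.

Lemma grading_fsum g (I : choiceType) (F : I -> V) :
  (forall i, c g (F i)) -> c g (\sum_(i \in [set: I]) F i).
Proof.
move=> cF; elim/big_ind: _ => // [|x y]; first exact: grading0.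
exact: gradingD.
Qed.

Definition hpart (g : G) (x : V) : V := sval (cid (grading_ex cP x)) g.

Lemma hpart_fin x : finite_set [set g | hpart g x != 0].
Proof. by rewrite /hpart; case: cid => F []. Qed.

Lemma hpart_in g x : c g (hpart g x).
Proof. by rewrite /hpart; case: cid => F []. Qed.

Lemma hpart_sum x : \sum_(g \in [set: G]) hpart g x = x.
Proof. by rewrite /hpart; case: cid => F []. Qed.

Lemma hpart_eq (F : G -> V) x g :
    finite_set [set g | F g != 0] -> (forall g, c g (F g)) ->
  \sum_(g \in [set: G]) F g = x -> hpart g x = F g.
Proof.
move=> Ffin cF Fx; apply/eqP; rewrite -subr_eq0; apply/eqP.
have Nfin : finite_set [set g | - F g != 0].
  by apply: sub_finite_set Ffin => i /=; rewrite oppr_eq0.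
apply: (grading_uniq cP (F := fun g => hpart g x - F g)).
- have : finite_set ([set g | hpart g x != 0] `|` [set g | - F g != 0]).
    by rewrite finite_setU; split=> //; exact: hpart_fin.
  apply: sub_finite_set => i /=.
  by case: (eqVneq (hpart i x) 0) => [->|]; rewrite ?sub0r; [right|left].
- by move=> i; apply: gradingB => //; apply: hpart_in.
rewrite fsumD //; last exact: hpart_fin.
by rewrite hpart_sum -(fsum_raddf (-%R)) //= Fx subrr.
Qed.

Lemma hpart_id g x : c g x -> hpart g x = x.
Proof.
move=> cx; rewrite (@hpart_eq (fun k => if k == g then x else 0)) ?eqxx //.
- apply: (@seq_finsupp _ _ _ [:: g]) => i; rewrite inE.
  by case: ifP => //; rewrite eqxx.
- by move=> k; case: eqP => [->|] // _; exact: (grading0 cP).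
by rewrite (@fsum_single _ _ _ g) ?eqxx // => i /negPf ->.
Qed.

Lemma hpart_neq g k x : c k x -> k != g -> hpart g x = 0.
Proof.
move=> cx kg; rewrite (@hpart_eq (fun i => if i == k then x else 0)).
- by rewrite eq_sym (negPf kg).
- apply: (@seq_finsupp _ _ _ [:: k]) => i; rewrite inE.
  by case: ifP => //; rewrite eqxx.
- by move=> i; case: eqP => [->|] // _; exact: (grading0 cP).
by rewrite (@fsum_single _ _ _ k) ?eqxx // => i /negPf ->.
Qed.

Fact hpart_is_zmod_morphism g : zmod_morphism (hpart g).
Proof.
move=> x y; apply: (@hpart_eq (fun g => hpart g x - hpart g y)).
- have : finite_set ([set g | hpart g x != 0] `|` [set g | hpart g y != 0]).
    by rewrite finite_setU; split=> //; exact: hpart_fin.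
  apply: sub_finite_set => i /=; case: (eqVneq (hpart i x) 0) => [->|]; last by left.
  by rewrite sub0r oppr_eq0; right.
- by move=> i; apply: gradingB => //; apply: hpart_in.
have yfin : finite_set [set g | - hpart g y != 0].
  by apply: sub_finite_set (hpart_fin y) => i /=; rewrite oppr_eq0.
rewrite fsumD //; last exact: hpart_fin.
rewrite hpart_sum; congr (_ + _).
by rewrite -(fsum_raddf (-%R)) ?hpart_sum //; exact: hpart_fin.
Qed.
HB.instance Definition _ g :=
  GRing.isZmodMorphism.Build V V (hpart g) (hpart_is_zmod_morphism g).

Lemma hpart0 g : hpart g 0 = 0. Proof. exact: raddf0. Qed.
Lemma hpartD g x y : hpart g (x + y) = hpart g x + hpart g y.
Proof. exact: raddfD. Qed.

Lemma grading_ind (P : V -> Prop) :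
    P 0 -> (forall x y, P x -> P y -> P (x + y)) ->
    (forall g x, c g x -> P x) -> forall x, P x.
Proof.
move=> P0 PD Pc x; rewrite -(hpart_sum x).
by elim/big_ind: _ => // i _; apply: (Pc i); apply: hpart_in.
Qed.

End GradingTheory.

Lemma dsum_grading (G : zmodType) (N : G -> zmodType) :
  is_grading (fun (g : G) => [set u : dsum N | forall k, k != g -> u k = 0]).
Proof.
pose e_ (u : dsum N) g : dprod N :=
  fun k => if k == g then u k else 0.
have e_fin u g : e_ u g \in finsupp (N := N).
  apply/asboolP; apply: sub_finite_set (dsum_fin u) => k /=.
  by rewrite /e_; case: ifP; rewrite ?eqxx.
pose e u g := DSum (e_fin u g).
have eE u g k : e u g k = if k == g then u k else 0 by [].
apply: (is_grading_proj (p := fun g u => e u g)).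
- by [].
- by move=> g x y x0 y0 k kg; rewrite dsumDE dsumNE x0 // y0 // subrr.
- move=> u; exists (e u).
  have efin : finite_set [set g | e u g != 0].
    apply: sub_finite_set (dsum_fin u) => g /=; apply: contraNneq => ug.
    by apply/eqP/dsumP => k; rewrite eE; case: eqP => // ->.
  split=> // [g k /negPf kg|]; first by rewrite eE kg.
  apply: dsumP => k.
  have evB : zmod_morphism (fun u : dsum N => u k) by [].
  pose ev : {additive dsum N -> N k} :=
    HB.pack (fun u : dsum N => u k) (GRing.isZmodMorphism.Build _ _ _ evB).
  rewrite -[RHS]/(ev _) fsum_raddf //= (@fsum_single _ _ _ k) /= ?eE ?eqxx //.
  by move=> i ik; rewrite eE eq_sym (negPf ik).
- move=> g x y; apply: dsumP => k; rewrite dsumDE dsumNE !eE dsumDE dsumNE.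
  by case: eqP; rewrite ?subr0.
- by move=> g u u0; apply: dsumP => k; rewrite eE; case: eqP => // /eqP /u0.
move=> g k u kg u0; apply: dsumP => i; rewrite eE; case: eqP => // ->.
by rewrite u0 // eq_sym.
Qed.

Record gring (G : zmodType) : Type := GRing_ {
  gring_sort :> comPzRingType;
  gring_comp : G -> set gring_sort;
  gring_grading : is_grading gring_comp;
  gring_mul : forall g g' x y,
    gring_comp g x -> gring_comp g' y -> gring_comp (g + g') (x * y)
}.

Record gmod (G : zmodType) (R : gring G) : Type := GMod {
  gmod_sort :> lmodType R;
  gcomp : G -> set gmod_sort;
  gmod_grading : is_grading gcomp;
  gmod_scale : forall g g' (r : R) (x : gmod_sort),
    gring_comp g r -> gcomp g' x -> gcomp (g + g') (r *: x)
}.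

Record gringmor (G : zmodType) (R S : gring G) : Type := GRingMor {
  gringmor_fun :> {rmorphism R -> S};
  gringmor_deg : forall g r,
    gring_comp g r -> gring_comp g (gringmor_fun r)
}.

Section Category.
Variables (G : zmodType) (R : gring G).
Implicit Types (M N P : gmod R).

Definition gmor_pred M N : {pred M -> N} :=
  fun f => `[< linear f /\ forall g x, gcomp g x -> gcomp g (f x) >].

Fact gmor_zmod_closed M N : zmod_closed (@gmor_pred M N).
Proof.
have zE x : (0 : M -> N) x = 0 by [].
have BE (f f' : M -> N) x : (f - f') x = f x - f' x by [].
split=> [|f f' /asboolP [fl fd] /asboolP [f'l f'd]]; apply/asboolP; split.
- by move=> a x y; rewrite !zE scaler0 addr0.
- by move=> g x _; apply: (grading0 (gmod_grading N)).
- by move=> a x y; rewrite !BE fl f'l opprD addrACA -scalerBr.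
- move=> g x gx; rewrite BE.
  by apply: (gradingB (gmod_grading N)); [apply: fd|apply: f'd].
Qed.
HB.instance Definition _ M N :=
  GRing.isZmodClosed.Build (M -> N) (@gmor_pred M N) (gmor_zmod_closed M N).

Record gmor M N : Type :=
  GMor { gmor_fun : M -> N; _ : gmor_fun \in @gmor_pred M N }.
HB.instance Definition _ M N := [isSub for @gmor_fun M N].
HB.instance Definition _ M N := [Choice of gmor M N by <:].
HB.instance Definition _ M N := [SubChoice_isSubZmodule of gmor M N by <:].
Coercion gmor_fun : gmor >-> Funclass.

Fact gmor_fun_is_linear M N (f : gmor M N) : linear f.
Proof. by case: f => f /= /asboolP []. Qed.
HB.instance Definition _ M N (f : gmor M N) :=
  GRing.isLinear.Build R M N *:%R (gmor_fun f) (gmor_fun_is_linear f).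

Lemma gmor_deg M N (f : gmor M N) g x : gcomp g x -> gcomp g (f x).
Proof. by case: f => f /= /asboolP [_ fd]; exact: fd. Qed.

Lemma gmorP M N (f f' : gmor M N) : f =1 f' -> f = f'.
Proof. by move=> ff'; apply/val_inj/funext. Qed.

Lemma gmorDE M N (f f' : gmor M N) x : (f + f') x = f x + f' x.
Proof. by []. Qed.
Lemma gmorNE M N (f : gmor M N) x : (- f) x = - f x. Proof. by []. Qed.
Lemma gmor0E M N x : (0 : gmor M N) x = 0. Proof. by []. Qed.

Definition mkgmor M N (f : M -> N) (fl : linear f)
    (fd : forall g x, gcomp g x -> gcomp g (f x)) : gmor M N :=
  GMor (asboolT (conj fl fd)).

Definition gid M : gmor M M :=
  @mkgmor M M id (fun _ _ _ => erefl) (fun _ _ => id).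

Fact gcompose_is_linear M N P (f : gmor N P) (f' : gmor M N) :
  linear (fun x => f (f' x)).
Proof. by move=> a x y; rewrite !linearP. Qed.
Definition gcompose M N P (f : gmor N P) (f' : gmor M N) : gmor M P :=
  mkgmor (gcompose_is_linear f f') (fun g x gx => gmor_deg f (gmor_deg f' gx)).

Definition is_mono M N (f : gmor M N) : Prop :=
  forall P (a b : gmor P M), gcompose f a = gcompose f b -> a = b.

Definition is_epi M N (f : gmor M N) : Prop :=
  forall P (a b : gmor N P), gcompose a f = gcompose b f -> a = b.

Definition is_iso M N (f : gmor M N) : Prop :=
  exists f' : gmor N M, gcompose f' f = gid M /\ gcompose f f' = gid N.

End Category.

Section Constructions.
Variables (G : zmodType) (R : gring G).

Section Shift.
Variables (M : gmod R) (g : G).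
Definition shift_comp (g' : G) : set M := gcomp (g + g').

Fact shift_grading : is_grading shift_comp.
Proof.
have gP := gmod_grading M.
have bij : bijective (+%R g) by exists (+%R (- g)); [exact: addKr|exact: addNKr].
split.
- by move=> k; apply: (grading0 gP).
- by move=> k x y; apply: (gradingB gP).
- move=> x; exists (fun k => hpart gP (g + k) x); split.
  + have [s _ sP] := finsupp_seq (hpart_fin gP x).
    apply: (@seq_finsupp _ _ _ (map (+%R (- g)) s)) => k /sP gk.
    by apply/mapP; exists (g + k); rewrite ?addKr.
  + by move=> k; apply: hpart_in.
  + by rewrite -[LHS](hpart_sum gP) (reindex_fsbigT (+%R g)) //.
move=> F Ffin cF F0 k.
have Fk := grading_uniq gP (F := fun k => F (- g + k)) _ _ _ (g + k).
rewrite addKr in Fk; apply: Fk.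
- have [s _ sP] := finsupp_seq Ffin.
  apply: (@seq_finsupp _ _ _ (map (+%R g) s)) => i /sP gi.
  by apply/mapP; exists (- g + i); rewrite ?addNKr.
- by move=> i; have := cF (- g + i); rewrite /shift_comp addNKr.
rewrite (reindex_fsbigT (+%R g)) // -[RHS]F0.
by apply: eq_fsbigr => i _; rewrite addKr.
Qed.

Fact shift_scale k k' (r : R) (x : M) :
  gring_comp k r -> shift_comp k' x -> shift_comp (k + k') (r *: x).
Proof. by rewrite /shift_comp addrCA; exact: gmod_scale. Qed.

(* [M(g)], with [M(g)_g' = M_(g + g')] *)
Definition shift : gmod R := GMod shift_grading shift_scale.
End Shift.

Definition gregular : gmod R :=
  @GMod G R R^o (@gring_comp G R) (gring_grading R) (@gring_mul G R).

Section DirectSum.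
Variables (J : Type) (N : J -> gmod R).

Definition gdsum_comp (g : G) : set (lsum N) :=
  [set u | forall j, gcomp g ((u : dsum _) j)].

Fact gdsum_grading : is_grading gdsum_comp.
Proof.
have gP j := gmod_grading (N j).
have p_fin g (u : lsum N) :
    ((fun j => hpart (gP j) g ((u : dsum _) j)) : dprod (fun j => N j))
      \in finsupp (N := fun j => N j).
  apply/asboolP; apply: sub_finite_set (dsum_fin u) => j /=.
  by apply: contraNneq => ->; rewrite raddf0.
pose p g (u : lsum N) : lsum N := DSum (p_fin g u).
have pE g (u : lsum N) j :
  (p g u : dsum _) j = hpart (gP j) g ((u : dsum _) j) by [].
apply: (is_grading_proj (p := p)).
- by move=> g j; apply: (grading0 (gP j)).
- by move=> g u v gu gv j; rewrite dsumDE dsumNE; apply: (gradingB (gP j)).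
- move=> u; exists (p^~ u).
  have pfin : finite_set [set g | p g u != 0].
    have : finite_set (\bigcup_(j in [set j | (u : dsum _) j != 0])
        [set g | hpart (gP j) g ((u : dsum _) j) != 0]).
      apply: bigcup_finite; first exact: dsum_fin.
      by move=> j _; apply: hpart_fin.
    apply: sub_finite_set => g /= pg0; apply/notP => nex.
    move/eqP: pg0; apply; apply: dsumP => j; rewrite pE dsum0E.
    apply/eqP/negP => /negP gj; apply: nex; exists j => //=.
    by apply: contraNneq gj => ->; rewrite raddf0.
  split=> // [g j|]; first by rewrite pE; apply: hpart_in.
  apply: dsumP => j.
  have evB : zmod_morphism (fun u : lsum N => (u : dsum _) j) by [].
  pose ev : {additive lsum N -> N j} :=
    HB.pack (fun u : lsum N => (u : dsum _) j)
      (GRing.isZmodMorphism.Build _ _ _ evB).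
  rewrite -[RHS]/(ev _) fsum_raddf //= -[LHS](hpart_sum (gP j)).
  by apply: eq_fsbigr.
- by move=> g u v; apply: dsumP => j; rewrite dsumDE dsumNE !pE -raddfB.
- by move=> g u gu; apply: dsumP => j; rewrite pE hpart_id.
by move=> g k u kg ku; apply: dsumP => j; rewrite pE (hpart_neq _ (ku j)).
Qed.

Fact gdsum_scale g g' (r : R) (u : lsum N) :
  gring_comp g r -> gdsum_comp g' u -> gdsum_comp (g + g') (r *: u).
Proof. by move=> gr gu j; apply: gmod_scale. Qed.

Definition gdsum : gmod R := GMod gdsum_grading gdsum_scale.
End DirectSum.

Section CanonicalMap.
Variables (M : gmod R) (J : Type) (N : J -> gmod R).

Fact dsum_hom_fin (u : dsum (fun j => gmor M (N j))) (x : M) :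
  ((fun j => u j x) : dprod (fun j => N j)) \in finsupp (N := fun j => N j).
Proof.
apply/asboolP; apply: sub_finite_set (dsum_fin u) => j /=.
by apply: contraNneq => ->.
Qed.

Fact dsum_hom_linear (u : dsum (fun j => gmor M (N j))) :
  linear (fun x => DSum (dsum_hom_fin u x) : gdsum N).
Proof. by move=> a x y; apply: dsumP => j; exact: linearP. Qed.

Fact dsum_hom_deg (u : dsum (fun j => gmor M (N j))) g x :
  gcomp g x -> gcomp g (DSum (dsum_hom_fin u x) : gdsum N).
Proof. by move=> gx j; apply: gmor_deg. Qed.

(* The canonical map from the direct sum of the groups Hom(M, N_j) to
   Hom(M, direct sum of the N_j). *)
Definition dsum_hom (u : dsum (fun j => gmor M (N j))) : gmor M (gdsum N) :=
  mkgmor (dsum_hom_linear u) (dsum_hom_deg u).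

Fact dsum_hom_is_zmod_morphism : zmod_morphism dsum_hom.
Proof. by move=> u v; apply: gmorP => x; apply: dsumP. Qed.
HB.instance Definition _ :=
  GRing.isZmodMorphism.Build _ _ dsum_hom dsum_hom_is_zmod_morphism.
End CanonicalMap.

Definition short_exact (A B C : zmodType) (f : A -> B) (g : B -> C) : Prop :=
  [/\ injective f, (forall y, g y = 0 <-> exists x, f x = y)
    & (forall z, exists y, g y = z)].

Definition finite_type (M : gmod R) : Prop :=
  exists (I : finType) (d : I -> G) (F : gmod R),
    (exists i : gmor F (gdsum (fun k => shift gregular (d k))), is_iso i) /\
    (exists p : gmor F M, is_epi p).

Definition projective (M : gmod R) : Prop :=
  forall (A B C : gmod R) (f : gmor A B) (g : gmor B C), short_exact f g ->
    short_exact (fun u : gmor M A => gcompose f u)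
                (fun u : gmor M B => gcompose g u).

Definition small (M : gmod R) : Prop :=
  forall (J : Type) (N : J -> gmod R), bijective (@dsum_hom M J N).

End Constructions.

Section Restriction.
Variables (G : zmodType) (R S : gring G).

Definition restr_sort (h : gringmor R S) (L : gmod S) : Type := L.

Variables (h : gringmor R S) (L : gmod S).
HB.instance Definition _ := GRing.Zmodule.on (restr_sort h L).

Definition restr_scale (r : R) (x : restr_sort h L) : restr_sort h L :=
  h r *: (x : L).

Fact restr_scaleA a b x :
  restr_scale a (restr_scale b x) = restr_scale (a * b) x.
Proof. by rewrite /restr_scale rmorphM scalerA. Qed.
Fact restr_scale1 : left_id 1 restr_scale.
Proof. by move=> x; rewrite /restr_scale rmorph1 scale1r. Qed.
Fact restr_scaleDr : right_distributive restr_scale +%R.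
Proof. by move=> a x y; exact: scalerDr. Qed.
Fact restr_scaleDl x : {morph restr_scale^~ x : a b / a + b}.
Proof. by move=> a b; rewrite /restr_scale rmorphD scalerDl. Qed.

HB.instance Definition _ := GRing.Zmodule_isLmodule.Build R (restr_sort h L)
  restr_scaleA restr_scale1 restr_scaleDr restr_scaleDl.

Fact restr_gscale g g' (r : R) (x : restr_sort h L) :
  gring_comp g r -> gcomp g' (x : L) -> gcomp (g + g') (r *: x : L).
Proof. by move=> gr gx; apply: gmod_scale => //; apply: gringmor_deg. Qed.

(* [h_* L] *)
Definition restr : gmod R :=
  @GMod G R (restr_sort h L) (@gcomp G S L) (gmod_grading L) restr_gscale.

Lemma restr_scaleE (r : R) (x : restr) : r *: x = (h r *: (x : L) : L).
Proof. by []. Qed.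

End Restriction.

Section Hom.
Variables (G : zmodType) (R : gring G) (M N : gmod R).

(* The direct sum of the groups Hom(M, N(g)), for [g] in [G]. *)
Definition hom : Type := dsum (fun g : G => gmor M (shift N g)).
HB.instance Definition _ := GRing.Zmodule.on hom.
Definition hom_part (u : hom) (g : G) : gmor M (shift N g) :=
  (u : dsum (fun g : G => gmor M (shift N g))) g.

(* The map M -> N given by an element of [hom]; a family is identified with
   the sum of its members, as [happ_inj] permits. *)
Definition happ (u : hom) (x : M) : N :=
  \sum_(g \in [set: G]) (hom_part u g x : N).

Lemma happ_fin (u : hom) x :
  finite_set [set g | (hom_part u g x : N) != 0].
Proof.
apply: sub_finite_set (dsum_fin u) => g /=.
by apply: contraNneq => ug; rewrite /hom_part ug.
Qed.

Lemma happD (u v : hom) x : happ (u + v) x = happ u x + happ v x.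
Proof. by rewrite -fsumD //; apply: happ_fin. Qed.

Lemma happ_linear (u : hom) : linear (happ u).
Proof.
move=> a x y; pose sc : {additive N -> N} := GRing.scale a.
have -> : a *: happ u x = \sum_(g \in [set: G]) a *: (hom_part u g x : N).
  exact: (fsum_raddf sc (happ_fin u x)).
rewrite -fsumD; last exact: happ_fin.
  by apply: eq_fsbigr => g _; rewrite linearP.
apply: sub_finite_set (happ_fin u x) => g /=.
by apply: contraNneq => ->; rewrite scaler0.
Qed.
HB.instance Definition _ (u : hom) :=
  GRing.isLinear.Build R M N *:%R (happ u) (happ_linear u).

Lemma hom_part_deg (u : hom) g k x :
  gcomp k x -> gcomp (g + k) (hom_part u g x : N).
Proof. by move=> kx; exact: (gmor_deg (hom_part u g) kx). Qed.

Lemma happ_inj (u v : hom) : happ u =1 happ v -> u = v.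
Proof.
move=> uv; apply: dsumP => g; apply: gmorP => x.
change (hom_part u g x = hom_part v g x).
elim/(grading_ind (gmod_grading M)): x => [|x y xE yE|k x kx].
- by rewrite !linear0.
- by rewrite [LHS]linearD [RHS]linearD; congr (_ + _).
have gP := gmod_grading N.
have E (w : hom) : hpart gP (g + k) (happ w x) = hom_part w g x.
  rewrite (@hpart_eq _ _ _ gP (fun i => hom_part w (i - k) x)) ?addrK //.
  - have [s _ sP] := finsupp_seq (happ_fin w x).
    apply: (@seq_finsupp _ _ _ (map (+%R^~ k) s)) => i /sP ik.
    by apply/mapP; exists (i - k); rewrite ?subrK.
  - by move=> i; have := hom_part_deg w (i - k) kx; rewrite subrK.
  rewrite (reindex_fsbigT (+%R^~ k)).
    by apply: eq_fsbigr => i _; rewrite addrK.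
  by exists (fun i => i - k) => i; rewrite ?addrK ?subrK.
by have := E u; rewrite uv E.
Qed.

Definition representable (f : M -> N) : Prop := exists u : hom, happ u =1 f.

Lemma representable0 : representable (fun=> 0).
Proof. by exists 0 => x; apply: fsbig1. Qed.

Lemma representableD f f' : representable f -> representable f' ->
  representable (fun x => f x + f' x).
Proof. by move=> [u uf] [v vf]; exists (u + v) => x; rewrite happD uf vf. Qed.

(* The element of [hom] with sum [f], unique by [happ_inj]. *)
Definition hom_of (f : M -> N) (fP : representable f) : hom := sval (cid fP).

Lemma hom_ofE f (fP : representable f) x : happ (hom_of fP) x = f x.
Proof. by rewrite /hom_of; case: cid. Qed.

Definition hom_comp (g : G) : set hom :=
  [set u | forall k, k != g -> hom_part u k = 0].

Lemma hom_grading : is_grading hom_comp.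
Proof. exact: (dsum_grading (fun g : G => gmor M (shift N g))). Qed.

Lemma happ_homog u g x : hom_comp g u -> happ u x = hom_part u g x.
Proof. by move=> gu; rewrite /happ (@fsum_single _ _ _ g) // => k /gu ->. Qed.

Lemma hom_comp_deg u g k x : hom_comp g u -> gcomp k x -> gcomp (g + k) (happ u x).
Proof. by move=> gu kx; rewrite (happ_homog _ gu); apply: hom_part_deg. Qed.

Fact hom_single_fin g (f : gmor M (shift N g)) :
  ((fun k => if k =P g is ReflectT kg then
      ecast g (gmor M (shift N g)) (esym kg) f else 0)
    : dprod (fun g : G => gmor M (shift N g)))
    \in finsupp (N := fun g : G => gmor M (shift N g)).
Proof.
apply/asboolP; apply: (sub_finite_set _ (finite_set1 g)) => k /=.
by case: eqP => //; rewrite eqxx.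
Qed.

Lemma hom_homog g (f : M -> N) (fl : linear f) :
    (forall k x, gcomp k x -> gcomp (g + k) (f x)) ->
  exists2 u : hom, happ u =1 f & hom_comp g u.
Proof.
move=> fd; pose u : hom := DSum (hom_single_fin (mkgmor (N := shift N g) fl fd)).
have ug : hom_comp g u by move=> k kg; rewrite /hom_part /= /u /dsum_fun /=; case: eqP kg.
exists u => // x; rewrite (happ_homog _ ug) /hom_part /dsum_fun /=.
by case: eqP => // e; rewrite (eq_irrelevance e erefl).
Qed.

Lemma happ_homogP u g : (forall k x, gcomp k x -> gcomp (g + k) (happ u x)) ->
  hom_comp g u.
Proof.
by move=> /(hom_homog (happ_linear u)) [v vu gv]; rewrite -(happ_inj vu).
Qed.

End Hom.

(* The graded [S]-module Hom_R(h_* L, M): the action of [s] on [u] is the family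
   whose sum is [y |-> u(s y)]. *)
Section HomS.
Variables (G : zmodType) (R S : gring G) (h : gringmor R S).
Variables (L : gmod S) (M : gmod R).

Definition homS_sort : Type := hom (restr h L) M.
HB.instance Definition _ := GRing.Zmodule.on homS_sort.
Implicit Types (s : S) (u v : homS_sort).

Lemma homS_act_subproof s u :
  representable (fun y : restr h L => happ u (s *: (y : L) : L)).
Proof.
elim/(grading_ind (gring_grading S)): s => [|s t sP tP|a s sa].
- have [w w0] := representable0 (restr h L) M.
  by exists w => y; rewrite w0 scale0r linear0.
- have [w wE] := representableD sP tP.
  by exists w => y; rewrite wE scalerDl linearD.
have lin v : linear (fun y : restr h L => happ v (s *: (y : L) : L)).
  move=> r x y; rewrite -linearP; congr (happ v _).
  by rewrite scalerDr restr_scaleE scalerA mulrC -scalerA.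
elim/(grading_ind (hom_grading (restr h L) M)): u => [|u v uP vP|g u gu].
- have [w w0] := representable0 (restr h L) M.
  by exists w => y; rewrite w0; apply/esym/fsbig1.
- have [w wE] := representableD uP vP.
  by exists w => y; rewrite wE happD.
have [k x kx|w wE _] := hom_homog (g := a + g) (lin u); last by exists w.
rewrite -addrA addrCA; apply: (hom_comp_deg gu).
exact: (gmod_scale (g0 := L) sa kx).
Qed.

Definition homS_act s u : homS_sort := hom_of (homS_act_subproof s u).

Lemma homS_actE s u y : happ (homS_act s u) y = happ u (s *: (y : L) : L).
Proof. exact: hom_ofE. Qed.

Fact homS_actA a b u : homS_act a (homS_act b u) = homS_act (a * b) u.
Proof.
by apply: happ_inj => y; rewrite !homS_actE scalerA mulrC.
Qed.
Fact homS_act1 : left_id 1 homS_act.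
Proof. by move=> u; apply: happ_inj => y; rewrite homS_actE scale1r. Qed.
Fact homS_actDr : right_distributive homS_act +%R.
Proof.
by move=> s u v; apply: happ_inj => y; rewrite happD !homS_actE happD.
Qed.
Fact homS_actDl u : {morph homS_act^~ u : a b / a + b}.
Proof.
move=> a b; apply: happ_inj => y; rewrite happD !homS_actE scalerDl.
exact: linearD.
Qed.

HB.instance Definition _ := GRing.Zmodule_isLmodule.Build S homS_sort
  homS_actA homS_act1 homS_actDr homS_actDl.

Fact homS_scale g g' s u :
  gring_comp g s -> hom_comp g' u -> hom_comp (g + g') (s *: u : homS_sort).
Proof.
move=> gs gu; apply: happ_homogP => k y ky; rewrite homS_actE -addrA addrCA.
by apply: (hom_comp_deg gu); exact: (gmod_scale (g0 := L) gs ky).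
Qed.

Definition homS : gmod S :=
  @GMod G S homS_sort (@hom_comp G R (restr h L) M)
    (hom_grading (restr h L) M) homS_scale.

End HomS.

(* The subgroup generated by [A]. *)
Section ZSpan.
Variables (V : zmodType) (A : set V).

Definition zspan : {pred V} := fun x => `[< forall P : set V,
  P 0 -> (forall y z, P y -> P z -> P (y - z)) -> A `<=` P -> P x >].

Fact zspan_zmod_closed : zmod_closed zspan.
Proof.
split=> [|x y /asboolP xP /asboolP yP]; apply/asboolP => P P0 PB AP //.
by apply: (PB); [exact: (xP P P0 PB AP) | exact: (yP P P0 PB AP)].
Qed.
HB.instance Definition _ := GRing.isZmodClosed.Build V zspan zspan_zmod_closed.

Lemma mem_zspan x : A x -> x \in zspan.
Proof. by move=> Ax; apply/asboolP => P _ _; apply. Qed.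

Lemma zspan_ind (P : set V) x : P 0 -> (forall y z, P y -> P z -> P (y - z)) ->
  A `<=` P -> x \in zspan -> P x.
Proof. by move=> P0 PB AP /asboolP; apply. Qed.
End ZSpan.

Section Tensor.
Variables (R : comPzRingType) (M N : lmodType R).

Inductive tens_rel : {freeg (M * N)} -> Prop :=
| TensRelDl x x' y : tens_rel (<< (x + x', y) >> - << (x, y) >> - << (x', y) >>)
| TensRelDr x y y' : tens_rel (<< (x, y + y') >> - << (x, y) >> - << (x, y') >>)
| TensRelZ r x y : tens_rel (<< (r *: x, y) >> - << (x, r *: y) >>).

Definition tens_sort : Type := Quotient.quot (zspan tens_rel : zmodClosed _).
HB.instance Definition _ := GRing.Zmodule.on tens_sort.

Definition tens_pi (z : {freeg (M * N)}) : tens_sort :=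
  (\pi_(Quotient.quot (zspan tens_rel : zmodClosed _)) z)%qT.

Definition tpure (x : M) (y : N) : tens_sort := tens_pi << (x, y) >>.

Fact tens_pi_is_zmod_morphism : zmod_morphism tens_pi.
Proof. by move=> x y; rewrite /tens_pi !piE. Qed.
HB.instance Definition _ :=
  GRing.isZmodMorphism.Build _ _ tens_pi tens_pi_is_zmod_morphism.

Lemma tens_pi_eq0 z : z \in zspan tens_rel -> tens_pi z = 0.
Proof.
move=> zr; rewrite -(raddf0 tens_pi); apply/eqP.
by rewrite -Quotient.idealrBE subr0.
Qed.

Lemma tpureDl x x' y : tpure (x + x') y = tpure x y + tpure x' y.
Proof.
apply/eqP; rewrite -subr_eq0 opprD addrA -!raddfB; apply/eqP.
by apply/tens_pi_eq0/mem_zspan; apply: TensRelDl.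
Qed.

Lemma tpureDr x y y' : tpure x (y + y') = tpure x y + tpure x y'.
Proof.
apply/eqP; rewrite -subr_eq0 opprD addrA -!raddfB; apply/eqP.
by apply/tens_pi_eq0/mem_zspan; apply: TensRelDr.
Qed.

Lemma tpureZ r x y : tpure (r *: x) y = tpure x (r *: y).
Proof.
apply/eqP; rewrite -subr_eq0 -raddfB; apply/eqP.
by apply/tens_pi_eq0/mem_zspan; apply: TensRelZ.
Qed.

Lemma tpure0l y : tpure 0 y = 0.
Proof. by apply: (addrI (tpure 0 y)); rewrite -tpureDl !addr0. Qed.
Lemma tpure0r x : tpure x 0 = 0.
Proof. by apply: (addrI (tpure x 0)); rewrite -tpureDr !addr0. Qed.
Lemma tpureNl x y : tpure (- x) y = - tpure x y.
Proof. by apply: (addrI (tpure x y)); rewrite -tpureDl !subrr tpure0l. Qed.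

Lemma tens_ind (P : tens_sort -> Prop) :
    P 0 -> (forall t t', P t -> P t' -> P (t + t')) ->
    (forall x y, P (tpure x y)) -> forall t, P t.
Proof.
move=> P0 PD Pp t.
have -> : t = tens_pi (repr t) by rewrite /tens_pi reprK.
rewrite -[repr t]freeg_sumE raddf_sum /=.
elim/big_ind: _ => // -[x y] _.
have -> : << coeff (x, y) (repr t) *g (x, y) >> =
    << (x, y) >> *~ coeff (x, y) (repr t) :> {freeg (M * N)}.
  by rewrite freegU_mulz intz.
rewrite raddfMz.
have PM x' z : P (tpure x' y *+ z).
  by elim: z => [|z Pz]; rewrite ?mulr0n // mulrS; exact: PD.
case: (coeff _ _) => z; first by rewrite -pmulrn; exact: PM.
by rewrite NegzE mulrNz -pmulrn -mulNrn -[- _]tpureNl; exact: PM.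
Qed.

Section Lift.
Variables (A : zmodType) (f : M -> N -> A).

Definition tfree (z : {freeg (M * N)}) : A :=
  fglift (fun p : M * N => f p.1 p.2 : zmodule A) z.

Fact tfree_is_zmod_morphism : zmod_morphism tfree.
Proof.
exact: (lift_is_additive (fun p : M * N => f p.1 p.2 : zmodule A)).
Qed.
HB.instance Definition _ :=
  GRing.isZmodMorphism.Build _ _ tfree tfree_is_zmod_morphism.

Lemma tfreeU x y : tfree << (x, y) >> = f x y.
Proof. by rewrite /tfree liftU scale1r. Qed.

(* Meaningful only when [f] is biadditive and balanced. *)
Definition tlift (t : tens_sort) : A := tfree (repr t).

Hypothesis fDl : forall x x' y, f (x + x') y = f x y + f x' y.
Hypothesis fDr : forall x y y', f x (y + y') = f x y + f x y'.
Hypothesis fZ : forall r x y, f (r *: x) y = f x (r *: y).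

Lemma tfree_rel z : z \in zspan tens_rel -> tfree z = 0.
Proof.
apply: (@zspan_ind _ _ (fun z => tfree z = 0)); first exact: raddf0.
- by move=> u v uE vE; rewrite raddfB /= uE vE subrr.
move=> _ [x x' y|x y y'|r x y]; rewrite !raddfB /= !tfreeU.
- by rewrite fDl -addrA -opprD subrr.
- by rewrite fDr -addrA -opprD subrr.
by rewrite fZ subrr.
Qed.

Lemma tlift_pi z : tlift (tens_pi z) = tfree z.
Proof.
apply/eqP; rewrite -subr_eq0 -raddfB; apply/eqP/tfree_rel.
by rewrite Quotient.idealrBE reprK.
Qed.

Lemma tlift_pure x y : tlift (tpure x y) = f x y.
Proof. by rewrite tlift_pi tfreeU. Qed.

Lemma tlift_is_zmod_morphism : zmod_morphism tlift.
Proof.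
move=> t t'.
have tE t'' : t'' = tens_pi (repr t'') by rewrite /tens_pi reprK.
by rewrite [in LHS](tE t) [in LHS](tE t') -raddfB tlift_pi raddfB.
Qed.

End Lift.
End Tensor.

Lemma tens_ext (R : comPzRingType) (M N : lmodType R) (A : zmodType)
    (f f' : tens_sort M N -> A) : zmod_morphism f -> zmod_morphism f' ->
  (forall x y, f (tpure x y) = f' (tpure x y)) -> f =1 f'.
Proof.
move=> fP f'P ff'.
pose fa : {additive tens_sort M N -> A} :=
  HB.pack f (GRing.isZmodMorphism.Build _ _ f fP).
pose fa' : {additive tens_sort M N -> A} :=
  HB.pack f' (GRing.isZmodMorphism.Build _ _ f' f'P).
rewrite -[f]/(fa : _ -> _) -[f']/(fa' : _ -> _).
elim/tens_ind => [|t t' tE t'E|x y]; last exact: ff'.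
  by rewrite !raddf0.
by rewrite !raddfD; congr (_ + _).
Qed.

Section TensorMap.
Variables (R : comPzRingType) (M N : lmodType R).

(* [phi] tensored with the identity of [N] *)
Definition tmap (phi : M -> M) : tens_sort M N -> tens_sort M N :=
  tlift (fun x y => tpure (phi x) y).

Variables (phi : {linear M -> M}).

Lemma tmap_pure x y : tmap phi (tpure x y) = tpure (phi x) y.
Proof.
apply: tlift_pure => [x1 x2 z|x1 z1 z2|r x1 z].
- by rewrite linearD tpureDl.
- exact: tpureDr.
- by rewrite linearZ tpureZ.
Qed.

Lemma tmap_is_zmod_morphism : zmod_morphism (tmap phi).
Proof.
apply: tlift_is_zmod_morphism => [x1 x2 z|x1 z1 z2|r x1 z].
- by rewrite linearD tpureDl.
- exact: tpureDr.
- by rewrite linearZ tpureZ.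
Qed.
HB.instance Definition _ :=
  GRing.isZmodMorphism.Build _ _ (tmap phi) tmap_is_zmod_morphism.
End TensorMap.

(* The module structure on the tensor product of M and N coming from an
   action [act] of a ring [A] on [M] by [R]-linear maps. *)
Section TensorAction.
Variables (R : comPzRingType) (M N : lmodType R) (A : pzRingType).
Variable act : A -> {linear M -> M}.
Hypothesis actA : forall a b x, act a (act b x) = act (a * b) x.
Hypothesis act1 : forall x, act 1 x = x.
Hypothesis actD : forall a b x, act (a + b) x = act a x + act b x.

Definition tact (a : A) : tens_sort M N -> tens_sort M N := tmap (act a).

Lemma tactA a b t : tact a (tact b t) = tact (a * b) t.
Proof.
apply: (@tens_ext _ _ _ _ (fun t => tact a (tact b t)) (tact (a * b))).
- by move=> u v; rewrite /tact !raddfB.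
- exact: tmap_is_zmod_morphism.
- by move=> x y; rewrite /tact !tmap_pure actA.
Qed.
Lemma tact1 : left_id 1 tact.
Proof.
apply: (@tens_ext _ _ _ _ (tact 1) id) => //; first exact: tmap_is_zmod_morphism.
by move=> x y; rewrite /tact tmap_pure act1.
Qed.
Lemma tactDr : right_distributive tact +%R.
Proof. by move=> a u v; rewrite /tact raddfD. Qed.
Lemma tactDl t : {morph tact^~ t : a b / a + b}.
Proof.
move=> a b; apply: (@tens_ext _ _ _ _ (tact (a + b)) (fun t => tact a t + tact b t)).
- exact: tmap_is_zmod_morphism.
- by move=> u v; rewrite /tact !raddfB addrACA opprD.
- by move=> x y; rewrite /tact !tmap_pure actD tpureDl.
Qed.
End TensorAction.

Section TensorGrading.
Variables (G : zmodType) (R : gring G) (M N : gmod R).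

(* The subgroup generated by the [x] tensor [y] with [deg x + deg y = g]. *)
Definition tens_comp (g : G) : set (tens_sort M N) :=
  [set t | t \in zspan [set t | exists a b x y,
    [/\ a + b = g, gcomp a x, gcomp b y & t = tpure x y]]].

Lemma tens_comp_pure a b x y : gcomp a x -> gcomp b y ->
  tens_comp (a + b) (tpure x y).
Proof. by move=> ax cy; apply: mem_zspan; exists a, b, x, y. Qed.

Let MP := gmod_grading M.
Let NP := gmod_grading N.

Definition tproj (g : G) (x : M) (y : N) : tens_sort M N :=
  \sum_(a \in [set: G]) tpure (hpart MP a x) (hpart NP (g - a) y).

Let tproj_fin g x y :
  finite_set [set a | tpure (hpart MP a x) (hpart NP (g - a) y) != 0].
Proof.
apply: sub_finite_set (hpart_fin MP x) => a /=.
by apply: contraNneq => ->; rewrite tpure0l.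
Qed.

Let tprojDl g x x' y : tproj g (x + x') y = tproj g x y + tproj g x' y.
Proof.
rewrite /tproj -fsumD; [|exact: tproj_fin|exact: tproj_fin].
by apply: eq_fsbigr => a _; rewrite hpartD tpureDl.
Qed.

Let tprojDr g x y y' : tproj g x (y + y') = tproj g x y + tproj g x y'.
Proof.
rewrite /tproj -fsumD; [|exact: tproj_fin|exact: tproj_fin].
by apply: eq_fsbigr => a _; rewrite hpartD tpureDr.
Qed.

Lemma hpart_scale (P : gmod R) c (r : R) (x : P) a : gring_comp c r ->
  hpart (gmod_grading P) a (r *: x) = r *: hpart (gmod_grading P) (a - c) x.
Proof.
move=> cr; have PP := gmod_grading P.
elim/(grading_ind PP): x => [|x y xE yE|k x kx].
- by rewrite scaler0 !hpart0 scaler0.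
- by rewrite scalerDr !hpartD xE yE scalerDr.
have ckx := gmod_scale cr kx.
have [->|ak] := eqVneq a (c + k).
  by rewrite addrAC subrr add0r !hpart_id.
rewrite (hpart_neq _ ckx) 1?eq_sym // (hpart_neq _ kx) ?scaler0 //.
by rewrite eq_sym subr_eq addrC.
Qed.

Let tprojZ g r x y : tproj g (r *: x) y = tproj g x (r *: y).
Proof.
elim/(grading_ind (gring_grading R)): r => [|r s rE sE|c r cr].
- rewrite !scale0r /tproj !fsbig1 // => a _.
    by rewrite hpart0 tpure0r.
  by rewrite hpart0 tpure0l.
- by rewrite !scalerDl tprojDl tprojDr rE sE.
rewrite /tproj (reindex_fsbigT (+%R^~ c)).
  apply: eq_fsbigr => a _.
  by rewrite !(hpart_scale _ _ cr) tpureZ addrK opprD addrA addrAC.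
by exists (fun i => i - c) => i; rewrite ?addrK ?subrK.
Qed.

Let tprojE g x y : tlift (tproj g) (tpure x y) = tproj g x y.
Proof. by apply: tlift_pure; [exact: tprojDl|exact: tprojDr|exact: tprojZ]. Qed.

Let tprojB g : zmod_morphism (tlift (tproj g)).
Proof.
by apply: tlift_is_zmod_morphism; [exact: tprojDl|exact: tprojDr|exact: tprojZ].
Qed.

Let tproj0 g : tlift (tproj g) 0 = 0.
Proof. by rewrite -[X in tlift _ X](subrr 0) tprojB subrr. Qed.

Lemma tens_grading : is_grading tens_comp.
Proof.
apply: (is_grading_proj (p := fun g => tlift (tproj g))).
- by move=> g; exact: rpred0.
- by move=> g t t'; exact: rpredB.
- elim/tens_ind => [|t t' [F [Ff Fc ->]] [F' [F'f F'c ->]]|x y].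
  + exists (fun=> 0); split.
      by apply: (@seq_finsupp _ _ _ [::]) => i; rewrite eqxx.
      by move=> g; exact: rpred0.
    by rewrite fsbig1.
  + exists (fun g => F g + F' g); split; last by rewrite fsumD.
      have : finite_set ([set g | F g != 0] `|` [set g | F' g != 0]).
        by rewrite finite_setU.
      apply: sub_finite_set => i /=.
      by case: (eqVneq (F i) 0) => [->|]; rewrite ?add0r; [right|left].
    by move=> g; apply: rpredD; [apply: Fc | apply: F'c].
  exists (fun g => tproj g x y).
  have [s us sP] := finsupp_seq (hpart_fin MP x).
  have [s' us' s'P] := finsupp_seq (hpart_fin NP y).
  pose s2 := undup (allpairs (fun a b : G => a + b) s s').
  have s2P g : tproj g x y != 0 -> g \in s2.
    apply: contraNT => gs2; apply/eqP; apply: fsbig1 => a _.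
    have [->|ax] := eqVneq (hpart MP a x) 0; first exact: tpure0l.
    have [->|bx] := eqVneq (hpart NP (g - a) y) 0; first exact: tpure0r.
    case/negP: gs2; rewrite mem_undup; apply/allpairsP; exists (a, g - a).
    by split; [exact: sP | exact: s'P | rewrite /= addrC subrK].
  split.
  + exact: seq_finsupp s2P.
  + move=> g; rewrite /tproj; elim/big_ind: _ => [|u v|a _].
    * exact: rpred0.
    * exact: rpredD.
    * by rewrite -{1}(subrK a g) addrC; apply: tens_comp_pure; apply: hpart_in.
  rewrite (fsumE (undup_uniq _) s2P) -[in LHS](hpart_sum MP x).
  rewrite -[in LHS](hpart_sum NP y) (fsumE us sP) (fsumE us' s'P).
  have -> : tpure (\sum_(i <- s) hpart MP i x) (\sum_(i <- s') hpart NP i y) =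
      \sum_(a <- s) tpure (hpart MP a x) (\sum_(i <- s') hpart NP i y).
    elim/big_ind2: _ => //; first exact: tpure0l.
    by move=> ? ? ? ? <- <-; rewrite tpureDl.
  transitivity (\sum_(g <- s2) \sum_(a <- s)
      tpure (hpart MP a x) (hpart NP (g - a) y)); last first.
    apply: eq_bigr => g _; rewrite /tproj (fsumE us) // => a.
    by move=> ta; apply: sP; apply: contraNneq ta => ->; rewrite tpure0l.
  rewrite exchange_big /=; apply: eq_big_seq => a sa.
  have -> : tpure (hpart MP a x) (\sum_(i <- s') hpart NP i y) =
      \sum_(b <- s') tpure (hpart MP a x) (hpart NP b y).
    elim/big_ind2: _ => //; first exact: tpure0r.
    by move=> ? ? ? ? <- <-; rewrite tpureDr.
  have bfin (F : G -> tens_sort M N) : (forall b, F b != 0 -> b \in s') ->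
      \sum_(b <- s') F b = \sum_(g <- s2) F (g - a).
    move=> Fs'; rewrite -(fsumE us' Fs').
    rewrite (reindex_fsbigT (fun g => g - a)).
      rewrite (@fsumE _ _ _ s2) ?undup_uniq // => g /Fs' gs'.
      rewrite mem_undup; apply/allpairsP; exists (a, g - a).
      by split=> //=; rewrite addrC subrK.
    by exists (+%R^~ a) => i; rewrite ?addrK ?subrK.
  rewrite bfin // => b tb; apply: s'P.
  by apply: contraNneq tb => ->; rewrite tpure0r.
- exact: tprojB.
- move=> g t; rewrite /tens_comp /=; apply: (@zspan_ind _ _
    (fun t => tlift (tproj g) t = t))
    => [|u v uE vE|_ [a [b [x [y [<- ax cy ->]]]]]].
  + exact: tproj0.
  + by rewrite tprojB uE vE.
  rewrite tprojE /tproj (@fsum_single _ _ _ a) => [|i ia].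
    by rewrite addrAC subrr add0r !hpart_id.
  by rewrite (hpart_neq _ ax) 1?eq_sym // tpure0l.
move=> g k t kg; rewrite /tens_comp /=; apply: (@zspan_ind _ _
  (fun t => tlift (tproj g) t = 0))
  => [|u v uE vE|_ [a [b [x [y [abk ax cy ->]]]]]].
- exact: tproj0.
- by rewrite tprojB uE vE subrr.
rewrite tprojE; apply: fsbig1 => i _.
have [->|ia] := eqVneq i a; last first.
  by rewrite (hpart_neq _ ax) 1?eq_sym // tpure0l.
rewrite (hpart_neq _ cy) ?tpure0r //; apply: contra kg => /eqP b_eq.
by rewrite -abk b_eq addrC subrK.
Qed.

End TensorGrading.

Section TensorModule.
Variables (R : comPzRingType) (M N : lmodType R).

Definition scale_lin (r : R) : {linear M -> M} := *:%R r.

HB.instance Definition _ := GRing.Zmodule_isLmodule.Build R (tens_sort M N)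
  (tactA (act := scale_lin) (@scalerA R M))
  (tact1 (act := scale_lin) (@scale1r R M))
  (tactDr scale_lin)
  (tactDl (act := scale_lin) (fun a b x => @scalerDl R M x a b)).

Lemma tens_scale_pure (r : R) (x : M) (y : N) :
  r *: tpure x y = tpure (r *: x) y.
Proof. exact: (tmap_pure (scale_lin r)). Qed.
End TensorModule.

Section GradedTensor.
Variables (G : zmodType) (R : gring G) (M N : gmod R).

Fact tens_gscale g g' (r : R) (t : tens_sort M N) :
  gring_comp g r -> tens_comp g' t -> tens_comp (g + g') (r *: t).
Proof.
move=> gr; apply: (@zspan_ind _ _ (fun t => tens_comp (g + g') (r *: t)))
  => [|u v uP vP|_ [a [b [x [y [<- ax cy ->]]]]]].
- by rewrite scaler0; exact: rpred0.
- by rewrite scalerBr; exact: rpredB.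
by rewrite tens_scale_pure addrA; apply: tens_comp_pure => //; apply: gmod_scale.
Qed.

Definition tens : gmod R :=
  @GMod G R (tens_sort M N) (@tens_comp G R M N) (tens_grading M N) tens_gscale.
End GradedTensor.

(* The graded [S]-module given by the tensor product over [R] of [h_* P] and
   [N], with [s (p tensor x) = (s p) tensor x]. *)
Section TensorS.
Variables (G : zmodType) (R S : gring G) (h : gringmor R S).

Section ScaleS.
Variable P : gmod S.
Definition scaleS (s : S) (x : restr h P) : restr h P := s *: (x : P).
Fact scaleS_is_linear s : linear (scaleS s).
Proof.
move=> r x y; rewrite /scaleS !restr_scaleE scalerDr !scalerA.
by rewrite mulrC.
Qed.
HB.instance Definition _ s :=
  GRing.isLinear.Build R (restr h P) (restr h P) *:%R (scaleS s)
    (scaleS_is_linear s).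
Definition scaleS_lin s : {linear restr h P -> restr h P} := scaleS s.
End ScaleS.

Variables (P : gmod S) (N : gmod R).
Definition tensS_sort : Type := tens_sort (restr h P) N.
HB.instance Definition _ := GRing.Zmodule.on tensS_sort.
HB.instance Definition _ := GRing.Zmodule_isLmodule.Build S tensS_sort
  (tactA (act := @scaleS_lin P) (@scalerA S P))
  (tact1 (act := @scaleS_lin P) (@scale1r S P))
  (tactDr (@scaleS_lin P))
  (tactDl (act := @scaleS_lin P) (fun a b x => @scalerDl S P x a b)).

Definition tpureS (x : P) (y : N) : tensS_sort := tpure (x : restr h P) y.

Lemma tensS_scale_pure (s : S) (x : P) (y : N) :
  s *: tpureS x y = tpureS (s *: x) y.
Proof. exact: (@tmap_pure R (restr h P) N (@scaleS_lin P s) x y). Qed.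

Fact tensS_gscale g g' (s : S) (t : tensS_sort) :
  gring_comp g s -> tens_comp g' t -> tens_comp (g + g') (s *: t : tensS_sort).
Proof.
move=> gs; apply: (@zspan_ind _ _
  (fun t => tens_comp (g + g') (s *: (t : tensS_sort) : tensS_sort)))
  => [|u v uP vP|_ [a [b [x [y [<- ax cy ->]]]]]].
- by rewrite scaler0; exact: rpred0.
- by rewrite (@scalerBr S tensS_sort); exact: rpredB.
rewrite -[tpure x y]/(tpureS x y) tensS_scale_pure addrA.
by apply: tens_comp_pure => //; apply: (gmod_scale (g0 := P) gs ax).
Qed.

Definition tensS : gmod S :=
  @GMod G S tensS_sort (@tens_comp G R (restr h P) N)
    (tens_grading (restr h P) N) tensS_gscale.
End TensorS.

Section Nu.
Variables (G : zmodType) (R S : gring G) (h : gringmor R S).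
Variables (L : gmod S) (M N : gmod R).
Implicit Types (u v : homS h L M) (x : N).

Fact nu_pure_subproof u x :
  representable (fun y : restr h L => tpure (happ u y) x : tens M N).
Proof.
elim/(grading_ind (gmod_grading N)): x => [|x x' xP x'P|b x bx].
- have [w w0] := representable0 (restr h L) (tens M N).
  by exists w => y; rewrite w0 tpure0r.
- have [w wE] := representableD xP x'P.
  by exists w => y; rewrite wE tpureDr.
have lin v : linear (fun y : restr h L => tpure (happ v y) x : tens M N).
  by move=> r y z; rewrite linearP tpureDl tens_scale_pure.
elim/(grading_ind (gmod_grading (homS h L M))): u => [|u v uP vP|g u gu].
- have [w w0] := representable0 (restr h L) (tens M N).
  exists w => y; rewrite w0; apply/esym.
  by rewrite /happ fsbig1 // tpure0l.
- have [w wE] := representableD uP vP.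
  by exists w => y; rewrite wE happD tpureDl.
have [k y ky|w wE _] := hom_homog (g := g + b) (lin u); last by exists w.
rewrite addrAC; apply: tens_comp_pure => //.
exact: (hom_comp_deg gu).
Qed.

(* [y |-> u(y) tensor x] *)
Definition nu_pure (u : homS h L M) (x : N) : homS h L (tens M N) :=
  hom_of (nu_pure_subproof u x).

Lemma nu_pureE u x y : happ (nu_pure u x) y = tpure (happ u y) x.
Proof. exact: hom_ofE. Qed.

Definition nu_fun : tensS h (homS h L M) N -> homS h L (tens M N) :=
  tlift (nu_pure : restr h (homS h L M) -> N -> homS h L (tens M N)).

Let nuDl u v x : nu_pure (u + v) x = nu_pure u x + nu_pure v x.
Proof. by apply: happ_inj => y; rewrite happD !nu_pureE happD tpureDl. Qed.
Let nuDr u x x' : nu_pure u (x + x') = nu_pure u x + nu_pure u x'.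
Proof. by apply: happ_inj => y; rewrite happD !nu_pureE tpureDr. Qed.
Let nuZ (r : R) (u : restr h (homS h L M)) x :
  nu_pure (r *: u) x = nu_pure u (r *: x).
Proof.
apply: happ_inj => y; rewrite !nu_pureE -tpureZ; congr (tpure _ x).
by rewrite [LHS]homS_actE -linearZ.
Qed.

Lemma nu_fun_pure (u : homS h L M) x y :
  happ (nu_fun (tpureS h u x)) y = tpure (happ u y) x.
Proof. by rewrite /nu_fun tlift_pure // nu_pureE. Qed.

Fact nu_fun_is_zmod_morphism : zmod_morphism nu_fun.
Proof. exact: tlift_is_zmod_morphism. Qed.

Fact nu_fun_is_linear : linear nu_fun.
Proof.
pose nua : {additive tensS h (homS h L M) N -> homS h L (tens M N)} :=
  HB.pack nu_fun (GRing.isZmodMorphism.Build _ _ nu_fun nu_fun_is_zmod_morphism).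
move=> s t t'; rewrite -[nu_fun]/(nua : _ -> _) raddfD; congr (_ + _).
apply: (@tens_ext _ (restr h (homS h L M)) N _
  (fun t => nua (s *: (t : tensS h (homS h L M) N))) (fun t => s *: nua t)).
- by move=> a b; rewrite (@scalerBr S (tensS_sort h (homS h L M) N)) raddfB.
- by move=> a b; rewrite raddfB scalerBr.
move=> u x; rewrite -[tpure u x]/(tpureS h u x).
rewrite [s *: _](tensS_scale_pure h s u x).
apply: happ_inj => y; rewrite [LHS]nu_fun_pure [RHS]homS_actE nu_fun_pure.
by congr (tpure _ x); rewrite [LHS]homS_actE.
Qed.

Fact nu_fun_deg g t : gcomp g t -> gcomp g (nu_fun t).
Proof.
have nuB := nu_fun_is_zmod_morphism.
have nu0 : nu_fun 0 = 0 by rewrite -[X in nu_fun X](subrr 0) nuB subrr.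
have hP := gmod_grading (homS h L (tens M N)).
apply: (@zspan_ind _ _ (fun t => gcomp g (nu_fun t)))
  => [|u v uP vP|_ [a [b [u [x [<- au cx ->]]]]]].
- by rewrite nu0; apply: (grading0 hP).
- by rewrite nuB; apply: (gradingB hP).
apply: happ_homogP => k y ky; rewrite nu_fun_pure addrAC.
by apply: tens_comp_pure => //; apply: (hom_comp_deg au).
Qed.

(* The morphism [u tensor x |-> (y |-> u(y) tensor x)] of graded [S]-modules *)
Definition nu : gmor (tensS h (homS h L M) N) (homS h L (tens M N)) :=
  mkgmor nu_fun_is_linear nu_fun_deg.

Lemma nuE (u : homS h L M) (x : N) (y : L) :
  happ (nu (tpureS h u x)) y = tpure (happ u y) x.
Proof. exact: nu_fun_pure. Qed.

End Nu.

(* Main.v *)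
Require Import Defs.
From mathcomp Require Import all_boot all_algebra.
From HB Require Import structures.
From mathcomp Require Import boolp classical_sets cardinality fsbigop.

(** A projective graded module has a dual basis (b_j, phi_j) made of homogeneous
    elements and homogeneous coordinate functions; it is finite if the module is
    moreover of finite type.

    Given one for N, let c_j be the contraction u (x) x |-> phi_j(x) u, defined
    on any tensor product with N.  Every tensor t is the sum of the
    c_j(t) (x) b_j, and c_j(nu(t)(y)) = c_j(t)(y), so nu(t) = 0 forces t = 0.
    A homogeneous w is the image of the sum of the (c_j o w) (x) b_j as soon as
    c_j o w = 0 for almost all j.  This is clear if there are finitely many j;
    if h_*(L) is small, it holds because the c_j o w are the components of a
    morphism from h_*(L) to a direct sum of shifts of M.

    Given a finite dual basis for h_*(L), the inverse of nu sends w to the sum of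
    the images of the w(b_j) under m (x) x |-> (y |-> phi_j(y) m) (x) x. *)

Set Implicit Arguments.
Unset Strict Implicit.
Unset Printing Implicit Defensive.

Import GRing.Theory.

Local Open Scope classical_set_scope.
Local Open Scope ring_scope.

(** * Graded components and bijective morphisms *)

Section Morphisms.
Variables (G : zmodType) (R : gring G).

Lemma hpart_gmor (A B : gmod R) (f : gmor A B) g x :
  hpart (gmod_grading B) g (f x) = f (hpart (gmod_grading A) g x).
Proof.
elim/(grading_ind (gmod_grading A)): x => [|x y xE yE|k x kx].
- by rewrite hpart0 !linear0 hpart0.
- by rewrite hpartD !linearD hpartD xE yE.
have kfx := gmor_deg f kx.
have [<-|kg] := eqVneq k g; first by rewrite !hpart_id.
by rewrite (hpart_neq _ kfx kg) (hpart_neq _ kx kg) linear0.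
Qed.

Lemma inj_is_mono (A B : gmod R) (f : gmor A B) : injective f -> is_mono f.
Proof.
move=> fI P a b ab; apply: gmorP => x; apply: fI.
by rewrite -[LHS]/(gcompose f a x) ab.
Qed.

Lemma bij_is_iso (A B : gmod R) (f : gmor A B) :
  injective f -> (forall y, exists x, f x = y) -> is_iso f.
Proof.
move=> fI fS; pose f' y := sval (cid (fS y)).
have f'K y : f (f' y) = y := svalP (cid (fS y)).
have f'l : linear f' by move=> a x y; apply: fI; rewrite linearP /= !f'K.
have f'd g y : gcomp g y -> gcomp g (f' y).
  (* Since [f] commutes with taking components, [f' y] and its component of degree [g] have the same
     image [y]; injectivity of [f] identifies them. *)
  move=> gy; suff -> : f' y = hpart (gmod_grading A) g (f' y) by apply: hpart_in.
  by apply: fI; rewrite -hpart_gmor !f'K hpart_id.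
exists (mkgmor f'l f'd); split; apply: gmorP => x; [apply: fI|]; exact: f'K.
Qed.

(** * Graded kernels and splittings onto projectives *)

Section Kernel.
Variables (A B : gmod R) (f : gmor A B).

Definition kernel_pred : {pred A} := fun x => f x == 0.

Fact kernel_submod_closed : submod_closed kernel_pred.
Proof.
split=> [|a x y]; rewrite /kernel_pred !unfold_in; first by rewrite linear0.
by move=> /eqP fx /eqP fy; rewrite linearP /= fx fy scaler0 addr0.
Qed.
HB.instance Definition _ :=
  GRing.isSubmodClosed.Build R A kernel_pred kernel_submod_closed.

Record kernel_sort : Type :=
  Kernel { kernel_val : A; _ : kernel_val \in kernel_pred }.
HB.instance Definition _ := [isSub for kernel_val].
HB.instance Definition _ := [Choice of kernel_sort by <:].
HB.instance Definition _ := [SubChoice_isSubLmodule of kernel_sort by <:].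

Definition kernel_comp (g : G) : set kernel_sort :=
  [set u | gcomp g (kernel_val u)].

Fact kernel_grading : is_grading kernel_comp.
Proof.
pose gP := gmod_grading A.
(* Components of a kernel element stay in the kernel, because [f] commutes with taking
   components. *)
have [s sP] : exists s : G -> kernel_sort -> kernel_sort,
    forall g u, val (s g u) = hpart gP g (val u).
  have hK g (u : kernel_sort) : hpart gP g (val u) \in kernel_pred.
    have /eqP fu : f (val u) == 0 := valP u.
    by apply/eqP; rewrite -hpart_gmor fu hpart0.
  by exists (fun g u => Kernel (hK g u)).
split=> [g|g x y|u|F Ffin cF F0 g].
- exact: (grading0 gP).
- exact: (gradingB gP).
- exists (s^~ u); split.
  + apply: sub_finite_set (hpart_fin gP (val u)) => g /=.
    by apply: contraNneq => su; apply/eqP/val_inj; rewrite sP.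
  + by move=> g; rewrite /kernel_comp /= -[kernel_val _]/(val _) sP; apply: hpart_in.
  have sfin : finite_set [set g | s g u != 0].
    apply: sub_finite_set (hpart_fin gP (val u)) => g /=.
    by apply: contraNneq => su; apply/eqP/val_inj; rewrite sP.
  apply: val_inj; rewrite (fsum_raddf (val : {additive _ -> A}) sfin).
  by rewrite -[LHS](hpart_sum gP); apply: eq_fsbigr => g _; rewrite /= sP.
apply: val_inj; apply: (grading_uniq gP (F := val \o F)) => //=.
by rewrite -[LHS](fsum_raddf (val : {additive _ -> A}) Ffin) F0.
Qed.

Fact kernel_gscale g g' (r : R) (u : kernel_sort) :
  gring_comp g r -> kernel_comp g' u -> kernel_comp (g + g') (r *: u).
Proof. exact: gmod_scale. Qed.

Definition kernel : gmod R := GMod kernel_grading kernel_gscale.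

Definition kernel_incl : gmor kernel A :=
  @mkgmor _ _ kernel A kernel_val (fun _ _ _ => erefl) (fun _ _ => id).

Lemma kernel_short_exact : (forall y, exists x, f x = y) ->
  short_exact kernel_incl f.
Proof.
move=> fS; split=> // [u v uv|x]; first exact: val_inj.
split=> [/eqP fx|[[y /eqP fy] <- //]].
by exists (Kernel (fx : x \in kernel_pred)).
Qed.
End Kernel.

(** Projectivity is stated through short exact sequences, so it is applied to the one formed by the
    kernel of [p]; the section is a lift of the identity of [P]. *)
Lemma projective_split (A P : gmod R) (p : gmor A P) :
  projective P -> (forall y, exists x, p x = y) ->
  exists s : gmor P A, forall y, p (s y) = y.
Proof.
move=> Pproj pS; have pE := kernel_short_exact pS.
have [_ _ /(_ (gid P)) [s sE]] := Pproj _ _ _ _ _ pE.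
by exists s => y; rewrite -[LHS]/(gcompose p s y) sE.
Qed.

(** * Graded cokernels and surjectivity of epimorphisms *)

Section Cokernel.
Variables (A B : gmod R) (f : gmor A B).

Definition image_pred : {pred B} := fun y => `[< exists x, f x = y >].

Fact image_submod_closed : submod_closed image_pred.
Proof.
split=> [|a x y]; first by apply/asboolP; exists 0; exact: linear0.
move=> /asboolP [u <-] /asboolP [v <-]; apply/asboolP.
by exists (a *: u + v); rewrite linearP.
Qed.
HB.instance Definition _ :=
  GRing.isSubmodClosed.Build R B image_pred image_submod_closed.

Definition coker_sort : Type := Quotient.quot (image_pred : zmodClosed B).
HB.instance Definition _ := GRing.Zmodule.on coker_sort.

Definition coker_pi (y : B) : coker_sort :=
  (\pi_(Quotient.quot (image_pred : zmodClosed B)) y)%qT.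

Fact coker_pi_is_zmod_morphism : zmod_morphism coker_pi.
Proof. by move=> x y; rewrite /coker_pi !piE. Qed.
HB.instance Definition _ :=
  GRing.isZmodMorphism.Build _ _ coker_pi coker_pi_is_zmod_morphism.

Lemma coker_pi_eq0 y : coker_pi y = 0 <-> exists x, f x = y.
Proof.
rewrite -(raddf0 coker_pi); split.
  by move/eqP; rewrite -Quotient.idealrBE subr0 => /asboolP.
by move=> fy; apply/eqP; rewrite -Quotient.idealrBE subr0; apply/asboolP.
Qed.

Lemma coker_piK q : exists y, q = coker_pi y.
Proof. by exists (repr q); rewrite /coker_pi reprK. Qed.

(** The chosen representative of a class differs from [y] by an element of the image, which [k]
    preserves. Both the scalar action and the graded components descend to the quotient this way. *)
Fact coker_pi_lift (k : {additive B -> B}) :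
  (forall y, y \in image_pred -> k y \in image_pred) ->
  forall y, coker_pi (k (repr (coker_pi y))) = coker_pi (k y).
Proof.
move=> kI y; apply/eqP; rewrite -subr_eq0 -!raddfB; apply/eqP/coker_pi_eq0.
apply/asboolP/kI; rewrite -[_ \in _]/(_ - _ \in (image_pred : zmodClosed B)).
by rewrite Quotient.idealrBE reprK.
Qed.

Definition coker_scale (r : R) (q : coker_sort) : coker_sort :=
  coker_pi (r *: repr q).

Lemma coker_scale_pi r y : coker_scale r (coker_pi y) = coker_pi (r *: y).
Proof. by apply: (coker_pi_lift (k := *:%R r)) => z; exact: rpredZ. Qed.

Fact coker_scaleA a b q : coker_scale a (coker_scale b q) = coker_scale (a * b) q.
Proof. by have [y ->] := coker_piK q; rewrite !coker_scale_pi scalerA. Qed.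
Fact coker_scale1 : left_id 1 coker_scale.
Proof. by move=> q; have [y ->] := coker_piK q; rewrite coker_scale_pi scale1r. Qed.
Fact coker_scaleDr : right_distributive coker_scale +%R.
Proof.
move=> r q q'; have [y ->] := coker_piK q; have [y' ->] := coker_piK q'.
by rewrite -raddfD !coker_scale_pi scalerDr raddfD.
Qed.
Fact coker_scaleDl q : {morph coker_scale^~ q : a b / a + b}.
Proof.
by move=> a b; have [y ->] := coker_piK q; rewrite !coker_scale_pi scalerDl raddfD.
Qed.
HB.instance Definition _ := GRing.Zmodule_isLmodule.Build R coker_sort
  coker_scaleA coker_scale1 coker_scaleDr coker_scaleDl.

Definition coker_comp (g : G) : set coker_sort := coker_pi @` gcomp g.

Fact coker_grading : is_grading coker_comp.
Proof.
pose gP := gmod_grading B.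
pose p g (q : coker_sort) := coker_pi (hpart gP g (repr q)).
have pE g y : p g (coker_pi y) = coker_pi (hpart gP g y).
  apply: (coker_pi_lift (k := hpart gP g)) => z /asboolP [x <-].
  by apply/asboolP; exists (hpart (gmod_grading A) g x); rewrite /= hpart_gmor.
apply: (is_grading_proj (p := p)).
- by move=> g; exists 0; rewrite ?raddf0 //; apply: (grading0 gP).
- move=> g _ _ [x gx <-] [y gy <-].
  by exists (x - y); rewrite ?raddfB //; apply: (gradingB gP).
- move=> q; have [y ->] := coker_piK q.
  exists (fun g => coker_pi (hpart gP g y)); split.
  + apply: sub_finite_set (hpart_fin gP y) => g /=.
    by apply: contraNneq => ->; rewrite raddf0.
  + by move=> g; exists (hpart gP g y) => //; apply: hpart_in.
  by rewrite -[in LHS](hpart_sum gP y) fsum_raddf //; apply: hpart_fin.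
- move=> g q q'; have [y ->] := coker_piK q; have [y' ->] := coker_piK q'.
  by rewrite -raddfB !pE !raddfB.
- by move=> g _ [y gy <-]; rewrite pE hpart_id.
by move=> g k _ kg [y ky <-]; rewrite pE (hpart_neq _ ky kg) raddf0.
Qed.

Fact coker_gscale g g' (r : R) (q : coker_sort) :
  gring_comp g r -> coker_comp g' q -> coker_comp (g + g') (r *: q).
Proof.
move=> gr [y gy <-]; exists (r *: y); first exact: gmod_scale.
by rewrite -coker_scale_pi.
Qed.

Definition coker : gmod R := GMod coker_grading coker_gscale.

Fact coker_pi_is_linear : linear (coker_pi : B -> coker).
Proof.
by move=> r x y; rewrite raddfD; congr (_ + _); apply/esym/coker_scale_pi.
Qed.

Definition coker_proj : gmor B coker :=
  @mkgmor _ _ B coker coker_pi coker_pi_is_linear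
    (fun g y gy => ex_intro2 _ _ y gy erefl).

(** The projection to the cokernel and the zero map agree after composition with [f]. Cancelling the
    epimorphism [f] makes the projection zero, so the image is all of [B]. *)
Lemma epi_surj : is_epi f -> forall y, exists x, f x = y.
Proof.
move=> fE y; apply/coker_pi_eq0.
have proj0 : coker_proj = 0.
  by apply: fE; apply: gmorP => x; apply/coker_pi_eq0; exists x.
by rewrite -[LHS]/(coker_proj y) proj0.
Qed.
End Cokernel.

End Morphisms.

(** * Homogeneous dual bases of projective modules *)

Section DualBasis.
Variables (G : zmodType) (R : gring G).

(** Each [phi j] is homogeneous of degree [- d j]; stating this as a property lets all coordinates
    share the target [R^o] instead of different shifts. Since a sum of infinite support is 0 by
    convention, [coord_fin] is what makes [coord_sum] a genuine expansion. *)
Record dual_basis (P : gmod R) (J : choiceType) (d : J -> G) (b : J -> P)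
    (phi : J -> {linear P -> R^o}) : Prop := DualBasis {
  basis_deg : forall j, gcomp (d j) (b j);
  coord_deg : forall j k x, gcomp k x -> gring_comp (k - d j) (phi j x);
  coord_fin : forall x, finite_set [set j | phi j x != 0];
  coord_sum : forall x, \sum_(j \in [set: J]) (phi j x : R) *: b j = x
}.

(* The component [e] of degree 0 of [1] satisfies [r * e = r] for homogeneous
   [r], hence for all [r]. *)
Lemma gring_comp1 : gring_comp 0 (1 : R).
Proof.
have RP := gring_grading R; pose e := hpart (gmod_grading (gregular R)) 0 1.
suff eE (r : R) : r * e = r.
  by rewrite -[1]eE mul1r; exact: (hpart_in (gmod_grading (gregular R))).
elim/(grading_ind RP): r => [|r s rE sE|c r cr]; first exact: mul0r.
  by rewrite mulrDl rE sE.
have := hpart_scale (1 : gregular R) c cr; rewrite subrr.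
rewrite (_ : r *: (1 : gregular R) = r); last exact: mulr1.
by rewrite (hpart_id (gmod_grading (gregular R)) cr).
Qed.

Section FreeModule.
Variables (J : choiceType) (e : J -> G).

Definition free_gmod : gmod R := gdsum (fun j => shift (gregular R) (e j)).

Definition free_coord (j : J) (u : free_gmod) : R :=
  (u : dsum (fun j => shift (gregular R) (e j))) j.

Lemma free_ext (u v : free_gmod) :
  (forall j, free_coord j u = free_coord j v) -> u = v.
Proof. exact: dsumP. Qed.

Lemma free_coord_fin (u : free_gmod) : finite_set [set j | free_coord j u != 0].
Proof. exact: (dsum_fin (u : dsum (fun j => shift (gregular R) (e j)))). Qed.

Fact free_coord_is_linear j : linear (free_coord j : free_gmod -> R^o).
Proof. by []. Qed.
HB.instance Definition _ j := GRing.isLinear.Build R free_gmod R^o *:%R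
  (free_coord j : free_gmod -> R^o) (free_coord_is_linear j).

Fact free_basis_fin (j : J) :
  ((fun k => if k == j then 1 else 0 : R)
    : dprod (fun j => shift (gregular R) (e j)))
    \in finsupp (N := fun j => shift (gregular R) (e j)).
Proof.
apply/asboolP; apply: (sub_finite_set _ (finite_set1 j)) => k /=.
by case: (eqVneq k j) => // _; rewrite eqxx.
Qed.
Definition free_basis (j : J) : free_gmod := DSum (free_basis_fin j).

Lemma free_coord_basis j k : free_coord k (free_basis j) = (k == j)%:R.
Proof. by rewrite /free_coord /dsum_fun /=; case: eqP. Qed.

(* The minus sign comes from [M(g)_g' = M_(g + g')]. *)
Lemma free_basis_deg j : gcomp (- e j) (free_basis j).
Proof.
move=> k; rewrite /free_basis /dsum_fun /=; case: (eqVneq k j) => [->|_].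
  by have := gring_comp1; rewrite -(subrr (e j)).
exact: (grading0 (gring_grading R)).
Qed.

Lemma free_sum (u : free_gmod) :
  u = \sum_(j \in [set: J]) free_coord j u *: free_basis j.
Proof.
have ufin : finite_set [set j | free_coord j u *: free_basis j != 0].
  apply: sub_finite_set (free_coord_fin u) => j /=.
  by apply: contraNneq => ->; rewrite scale0r.
apply: free_ext => k.
rewrite -[RHS]/((free_coord k : {linear free_gmod -> R^o}) _) (fsum_raddf _ ufin).
rewrite (@fsum_single _ _ _ k) /= => [|j jk].
  by rewrite linearZ /= free_coord_basis eqxx; apply/esym/mulr1.
by rewrite linearZ /= free_coord_basis eq_sym (negPf jk); apply: mulr0.
Qed.

(** For a section [s] of [p], take as [b] the image of the free basis and as [phi] the free
    coordinates of [s x]; applying [p] to the expansion of [s x] returns [x]. *)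
Lemma projective_dual_basis (P : gmod R) (p : gmor free_gmod P) :
    projective P -> (forall y, exists x, p x = y) ->
  exists b phi, @dual_basis P J (fun j => - e j) b phi.
Proof.
move=> Pproj pS; have [s sK] := projective_split Pproj pS.
pose phi j (x : P) : R^o := free_coord j (s x).
have phil j : linear (phi j) by move=> r x y; rewrite /phi !linearP.
pose phiL j : {linear P -> R^o} :=
  HB.pack (phi j) (GRing.isLinear.Build R P R^o *:%R (phi j) (phil j)).
exists (fun j => p (free_basis j)), phiL.
split=> [j|j k x kx|x|x] /=.
- exact/gmor_deg/free_basis_deg.
- by have := gmor_deg s kx j; rewrite opprK addrC.
- exact: free_coord_fin.
rewrite -[RHS]sK [in RHS](free_sum (s x)) fsum_raddf.
  by apply: eq_fsbigr => j _; apply/esym/linearZ.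
apply: sub_finite_set (free_coord_fin (s x)) => j /=.
by apply: contraNneq => ->; rewrite scale0r.
Qed.

Section FreeLift.
Variables (P : gmod R) (b : J -> P).
Hypothesis bd : forall j, gcomp (- e j) (b j).

Definition free_lift_fun (u : free_gmod) : P :=
  \sum_(j \in [set: J]) free_coord j u *: b j.

Let free_lift_fin u : finite_set [set j | free_coord j u *: b j != 0].
Proof.
apply: sub_finite_set (free_coord_fin u) => j /=.
by apply: contraNneq => ->; rewrite scale0r.
Qed.

Fact free_lift_is_linear : linear free_lift_fun.
Proof.
move=> r u v; rewrite /free_lift_fun.
have /= -> := fsum_raddf (GRing.scale r : {additive P -> P}) (free_lift_fin u).
rewrite -fsumD //; last first.
  apply: sub_finite_set (free_lift_fin u) => j /=.
  by apply: contraNneq => ->; rewrite scaler0.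
by apply: eq_fsbigr => j _; rewrite scalerA -scalerDl.
Qed.

Fact free_lift_deg g u : gcomp g u -> gcomp g (free_lift_fun u).
Proof.
move=> gu; apply: (grading_fsum (gmod_grading P)) => j.
by rewrite -[g](addrK (e j)) [g + _]addrC; apply: gmod_scale => //; apply: (gu j).
Qed.

Definition free_lift : gmor free_gmod P := mkgmor free_lift_is_linear free_lift_deg.

Lemma free_lift_basis j : free_lift (free_basis j) = b j.
Proof.
rewrite -[LHS]/(free_lift_fun _) /free_lift_fun (@fsum_single _ _ _ j) => [|k kj].
  by rewrite free_coord_basis eqxx scale1r.
by rewrite free_coord_basis (negPf kj) scale0r.
Qed.
End FreeLift.
End FreeModule.

(* The pairs [(g, x)], sent to the component of degree [g] of [x], provide a
   homogeneous generating family. *)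
Lemma projective_has_dual_basis (P : gmod R) : projective P ->
  exists (J : choiceType) (d : J -> G) (b : J -> P) phi, dual_basis d b phi.
Proof.
move=> Pproj; pose J : choiceType := (G * P)%type.
pose b (j : J) : P := hpart (gmod_grading P) j.1 j.2.
have bd j : gcomp (- (- j.1)) (b j) by rewrite opprK; apply: hpart_in.
pose p := free_lift (e := fun j : J => - j.1) bd.
have [|b' [phi ?]] := projective_dual_basis (p := p) Pproj.
  elim/(grading_ind (gmod_grading P)) => [|x y [u <-] [v <-]|g x gx].
  - by exists 0; rewrite linear0.
  - by exists (u + v); rewrite linearD.
  by exists (free_basis _ (g, x)); rewrite free_lift_basis /b hpart_id.
by exists J, (fun j => - - j.1), b', phi.
Qed.

(** Composing the epimorphism with the inverse of the isomorphism gives a map from the free module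
    itself, surjective by [epi_surj]. *)
Lemma finite_type_dual_basis (P : gmod R) : projective P -> finite_type P ->
  exists (J : finType) (d : J -> G) (b : J -> P) phi, dual_basis d b phi.
Proof.
move=> Pproj [J [e [F [[i [i' [i'K iK]]] [q qE]]]]].
pose p : gmor (free_gmod e) P := gcompose q i'.
have [|b [phi ?]] := projective_dual_basis (p := p) Pproj.
  move=> y; have [x <-] := epi_surj qE y; exists (i x); congr (q _).
  by rewrite -[LHS]/(gcompose i' i x) i'K.
by exists J, (fun j => - e j), b, phi.
Qed.

End DualBasis.

(** * Additivity of pure tensors and of evaluation *)

Section PureTensor.
Variables (R : comPzRingType) (M N : lmodType R).

Definition tpure_left (x : N) (m : M) : tens_sort M N := tpure m x.
Definition tpure_right (m : M) (x : N) : tens_sort M N := tpure m x.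

Fact tpure_left_is_zmod_morphism x : zmod_morphism (tpure_left x).
Proof. by move=> m m'; rewrite /tpure_left tpureDl tpureNl. Qed.
HB.instance Definition _ x :=
  GRing.isZmodMorphism.Build _ _ (tpure_left x) (tpure_left_is_zmod_morphism x).

Fact tpure_right_is_zmod_morphism m : zmod_morphism (tpure_right m).
Proof.
move=> x x'; rewrite /tpure_right tpureDr.
by rewrite -[- x']scaleN1r -tpureZ scaleN1r tpureNl.
Qed.
HB.instance Definition _ m :=
  GRing.isZmodMorphism.Build _ _ (tpure_right m) (tpure_right_is_zmod_morphism m).
End PureTensor.

Section Evaluation.
Variables (G : zmodType) (R : gring G) (M N : gmod R) (y : M).

Definition happ_at (u : Defs.hom M N) : N := happ u y.

Fact happ_at_is_zmod_morphism : zmod_morphism happ_at.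
Proof.
by move=> u v; apply: (addIr (happ v y)); rewrite -happD !subrK.
Qed.
HB.instance Definition _ :=
  GRing.isZmodMorphism.Build _ _ happ_at happ_at_is_zmod_morphism.

Lemma happB (u v : Defs.hom M N) : happ (u - v) y = happ u y - happ v y.
Proof. exact: (raddfB happ_at). Qed.

Lemma happ_sum I (s : seq I) (F : I -> Defs.hom M N) :
  happ (\sum_(i <- s) F i) y = \sum_(i <- s) happ (F i) y.
Proof. exact: (raddf_sum happ_at). Qed.
End Evaluation.

(** * Contraction along a dual basis of [N] *)

Section Contract.
Variables (G : zmodType) (R : gring G) (N : gmod R) (J : choiceType).
Variables (d : J -> G) (b : J -> N) (phi : J -> {linear N -> R^o}).
Hypothesis bP : dual_basis d b phi.

Section Module.
Variable M : lmodType R.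

(** This is the identity tensored with [phi j], followed by the identification of [M] tensor [R]
    with [M]. Here [M] is any module, as both the given [M] and the restriction of [homS h L M] are
    needed. *)
Definition contract (j : J) : tens_sort M N -> M :=
  tlift (fun m x => (phi j x : R) *: m).

Let cDl j (m m' : M) x :
  (phi j x : R) *: (m + m') = (phi j x : R) *: m + (phi j x : R) *: m'.
Proof. exact: scalerDr. Qed.
Let cDr j (m : M) x x' :
  (phi j (x + x') : R) *: m = (phi j x : R) *: m + (phi j x' : R) *: m.
Proof. by rewrite linearD; apply: scalerDl. Qed.
Let cZ j (r : R) (m : M) x :
  (phi j x : R) *: (r *: m) = (phi j (r *: x) : R) *: m.
Proof.
have -> : phi j (r *: x) = r * phi j x :> R by exact: (linearZ_LR (phi j) r x).
by rewrite scalerA mulrC.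
Qed.

Lemma contract_pure j m x : contract j (tpure m x) = (phi j x : R) *: m.
Proof. exact: tlift_pure. Qed.

Fact contract_is_zmod_morphism j : zmod_morphism (contract j).
Proof. exact: tlift_is_zmod_morphism. Qed.
HB.instance Definition _ j :=
  GRing.isZmodMorphism.Build _ _ (contract j) (contract_is_zmod_morphism j).

Lemma contractZ j (r : R) t : contract j (r *: t) = r *: contract j t.
Proof.
apply: (@tens_ext _ M N _ (fun t => contract j (r *: t))
  (fun t => r *: contract j t)) => [u v|u v|m x].
- by rewrite scalerBr raddfB.
- by rewrite raddfB scalerBr.
by rewrite tens_scale_pure !contract_pure !scalerA mulrC.
Qed.

Lemma contract_fin t : finite_set [set j | contract j t != 0].
Proof.
elim/tens_ind: t => [|t t' tP t'P|m x].
- by apply: (@seq_finsupp _ _ _ [::]) => j; rewrite raddf0 eqxx.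
- have : finite_set ([set j | contract j t != 0] `|` [set j | contract j t' != 0]).
    by rewrite finite_setU.
  apply: sub_finite_set => j /=; rewrite raddfD /=.
  by case: (eqVneq (contract j t) 0) => [->|]; rewrite ?add0r; [right|left].
apply: sub_finite_set (coord_fin bP x) => j /=.
by rewrite contract_pure; apply: contraNneq => ->; rewrite scale0r.
Qed.

(** For a pure tensor, expand [x] in the dual basis and move each scalar [phi j x] across the tensor
    sign. *)
Lemma contract_sum t : \sum_(j \in [set: J]) tpure (contract j t) (b j) = t.
Proof.
have cfin t' : finite_set [set j | tpure (contract j t') (b j) != 0].
  apply: sub_finite_set (contract_fin t') => j /=.
  by apply: contraNneq => ->; rewrite tpure0l.
elim/tens_ind: t => [|t t' tE t'E|m x].
- by apply: fsbig1 => j _; rewrite raddf0 tpure0l.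
- rewrite -[in RHS]tE -[in RHS]t'E -fsumD //.
  by apply: eq_fsbigr => j _; rewrite raddfD tpureDl.
rewrite -[in RHS](coord_sum bP x) -[RHS]/(tpure_right m _) fsum_raddf.
  by apply: eq_fsbigr => j _; rewrite contract_pure tpureZ.
apply: sub_finite_set (coord_fin bP x) => j /=.
by apply: contraNneq => ->; rewrite scale0r.
Qed.
End Module.

Lemma contract_deg (M : gmod R) j g (t : tens M N) :
  gcomp g t -> gcomp (g - d j) (contract j t).
Proof.
have MP := gmod_grading M.
apply: (@zspan_ind _ _ (fun t => gcomp (g - d j) (contract j t)))
  => [|u v uP vP|_ [k [l [m [x [<- km lx ->]]]]]].
- by rewrite raddf0; apply: (grading0 MP).
- by rewrite raddfB; apply: (gradingB MP).
rewrite contract_pure -addrA addrC; apply: gmod_scale => //.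
exact: (coord_deg bP).
Qed.

Variables (S : gring G) (h : gringmor R S) (L : gmod S) (M : gmod R).

(** On u tensor x both sides are phi_j(x) u(y): [R] acts on [homS h L M] by applying [h r] to the
    argument, and [u] is [R]-linear. *)
Lemma contract_nu j (t : tensS h (homS h L M) N) y :
  contract j (happ (nu h L M N t) y) =
  happ (contract j (t : tens_sort (restr h (homS h L M)) N) : homS h L M) y.
Proof.
apply: (@tens_ext _ (restr h (homS h L M)) N _
  (fun t => contract j (happ (nu h L M N t) y))
  (fun t => happ (contract j t : homS h L M) y)) => [u v|u v|u x].
- have -> : nu h L M N (u - v) = nu h L M N u - nu h L M N v by apply: raddfB.
  by rewrite happB raddfB.
- by rewrite raddfB; apply: happB.
rewrite nuE !contract_pure.
by rewrite -[RHS]/(happ (homS_act (h (phi j x)) u) y) homS_actE -linearZ.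
Qed.

Lemma nu_inj : injective (nu h L M N).
Proof.
move=> t t' tt'; apply/eqP; rewrite -subr_eq0; apply/eqP.
set s := t - t'; have s0 : nu h L M N s = 0.
  have -> : nu h L M N s = nu h L M N t - nu h L M N t' by apply: raddfB.
  by rewrite tt' subrr.
rewrite -[LHS](@contract_sum (restr h (homS h L M)) s); apply: fsbig1 => j _.
suff -> : contract j (s : tens_sort (restr h (homS h L M)) N) = 0.
  exact: tpure0l.
apply: (@happ_inj _ _ (restr h L) M) => y; rewrite -contract_nu s0.
have happ0 T : happ (0 : homS h L T) y = 0 by apply: fsbig1.
by rewrite !happ0 raddf0.
Qed.

(** Homogeneity of [w] gives each contraction of [w] the single degree [g - d j], so it is
    represented by an element of [hom]; finiteness allows these elements to be summed against the
    [b j]. *)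
Lemma nu_surj_homog g (w : homS h L (tens M N)) : gcomp g w ->
    finite_set [set j | exists y : restr h L, contract j (happ w y) != 0] ->
  exists t, nu h L M N t = w.
Proof.
move=> gw /finite_seqP [s sE].
have ex_u j : exists u : homS h L M,
    happ u =1 (fun y : restr h L => contract j (happ w y)).
  have [r x y|k y ky|u uE _] := @hom_homog _ _ (restr h L) M (g - d j)
      (fun y : restr h L => contract j (happ w y)).
  - by rewrite linearP raddfD -contractZ.
  - by rewrite addrAC; apply: contract_deg; exact: (hom_comp_deg gw).
  by exists u.
exists (\sum_(j <- undup s) tpureS h (sval (cid (ex_u j))) (b j)).
apply: happ_inj => y.
rewrite -[RHS](contract_sum (happ w y)) (@fsumE _ _ _ (undup s)) ?undup_uniq //.
  rewrite raddf_sum.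
  rewrite [LHS](@happ_sum _ _ (restr h L)); apply: eq_bigr => j _.
  by rewrite nuE (svalP (cid (ex_u j))).
(* For [j] outside [s] the contraction of [w] vanishes at every [y], so one finite list serves all
   [y] at once. *)
move=> j cj; rewrite mem_undup; have : [set` s] j; last by [].
by rewrite -sE /=; exists y; apply: contraNneq cj => ->; rewrite tpure0l.
Qed.
End Contract.

(** * Inverse of [nu] from a finite dual basis of [restr h L] *)

Section RankOne.
Variables (G : zmodType) (R S : gring G) (h : gringmor R S).
Variables (L : gmod S) (M N : gmod R) (J : finType).
Variables (d : J -> G) (b : J -> restr h L).
Variable phi : J -> {linear restr h L -> R^o}.
Hypothesis bP : dual_basis d b phi.

(** If [m] is homogeneous of degree [g], the map has the single degree [g - d j]; a general [m] is a
    finite sum of such elements. *)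
Fact rank_one_subproof j (m : M) :
  representable (fun y : restr h L => (phi j y : R) *: m).
Proof.
elim/(grading_ind (gmod_grading M)): m => [|m m' mP m'P|g m gm].
- have [w w0] := representable0 (restr h L) M.
  by exists w => y; rewrite w0 scaler0.
- have [w wE] := representableD mP m'P.
  by exists w => y; rewrite wE scalerDr.
have [r x y|k y ky|u uE _] := @hom_homog _ _ (restr h L) M (g - d j)
    (fun y : restr h L => (phi j y : R) *: m); last by exists u.
- by rewrite linearP scalerDl -scalerA.
rewrite -addrA addrC -[- d j + k]addrC.
by apply: gmod_scale => //; apply: (coord_deg bP).
Qed.

Definition rank_one j m : homS h L M := hom_of (rank_one_subproof j m).

Lemma rank_oneE j m y : happ (rank_one j m) y = (phi j y : R) *: m.
Proof. exact: hom_ofE. Qed.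

Definition expand j : tens_sort M N -> tensS h (homS h L M) N :=
  tlift (fun m x => tpureS h (rank_one j m) x).

Let eDl j m m' (x : N) : tpureS h (rank_one j (m + m')) x =
  tpureS h (rank_one j m) x + tpureS h (rank_one j m') x.
Proof.
rewrite -[RHS](@tpureDl _ (restr h (homS h L M))); congr tpure.
by apply: happ_inj => y; rewrite happD !rank_oneE scalerDr.
Qed.
Let eDr j m (x x' : N) : tpureS h (rank_one j m) (x + x') =
  tpureS h (rank_one j m) x + tpureS h (rank_one j m) x'.
Proof. exact: tpureDr. Qed.
Let eZ j (r : R) m (x : N) :
  tpureS h (rank_one j (r *: m)) x = tpureS h (rank_one j m) (r *: x).
Proof.
rewrite /tpureS -tpureZ; congr tpure; apply: happ_inj => y.
rewrite -[RHS]/(happ (homS_act (h r) (rank_one j m)) y) homS_actE !rank_oneE.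
have -> : phi j (h r *: (y : L) : L) = r * phi j y :> R.
  exact: (linearZ_LR (phi j) r y).
by rewrite scalerA mulrC.
Qed.

Lemma expand_pure j m x : expand j (tpure m x) = tpureS h (rank_one j m) x.
Proof. exact: tlift_pure. Qed.

Fact expand_is_zmod_morphism j : zmod_morphism (expand j).
Proof. exact: tlift_is_zmod_morphism. Qed.
HB.instance Definition _ j :=
  GRing.isZmodMorphism.Build _ _ (expand j) (expand_is_zmod_morphism j).

Lemma nu_expand j (t : tens M N) y :
  happ (nu h L M N (expand j t)) y = (phi j y : R) *: t.
Proof.
apply: (@tens_ext _ M N _ (fun t => happ (nu h L M N (expand j t)) y)
  (fun t : tens M N => (phi j y : R) *: t)) => [u v|u v|m x].
- by rewrite !raddfB; apply: happB.
- exact: scalerBr.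
by rewrite expand_pure nuE rank_oneE -tens_scale_pure.
Qed.

Lemma coord_sum_fin y : \sum_j (phi j y : R) *: b j = y.
Proof.
rewrite -[RHS](coord_sum bP y) (@fsumE _ _ _ (enum J)) ?enum_uniq ?big_enum //.
by move=> j _; rewrite mem_enum.
Qed.

(** On u tensor x the sum is v tensor x, where v(y) is the sum of the phi_j(y) u(b_j). This is u(y),
    by linearity of [u] and the expansion of [y]. *)
Lemma expand_nu t : \sum_j expand j (happ (nu h L M N t) (b j)) = t.
Proof.
apply: (@tens_ext _ (restr h (homS h L M)) N _
  (fun t => \sum_j expand j (happ (nu h L M N t) (b j))) id) => [u v|//|u x].
- rewrite -sumrB; apply: eq_bigr => j _.
  have -> : nu h L M N (u - v) = nu h L M N u - nu h L M N v by apply: raddfB.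
  by rewrite [happ _ _](@happB _ _ (restr h L)) raddfB.
under eq_bigr do rewrite nuE expand_pure.
pose v j : restr h (homS h L M) := rank_one j (happ u (b j)).
rewrite -[LHS]/(\sum_j tpure_left x (v j)).
rewrite -raddf_sum.
congr tpure; apply: (@happ_inj _ _ (restr h L) M) => y.
rewrite [LHS](@happ_sum _ _ (restr h L)) -[in RHS](coord_sum_fin y) linear_sum.
by apply: eq_bigr => j _; rewrite linearZ; apply: rank_oneE.
Qed.

Lemma nu_iso_fin_source : is_iso (nu h L M N).
Proof.
apply: bij_is_iso => [t t' tt'|w].
  by rewrite -[t]expand_nu tt' expand_nu.
(* By [nu_expand], the image of this element takes [y] to the sum of the phi_j(y) w(b_j), which is
   w(y). *)
exists (\sum_j expand j (happ w (b j))).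
apply: (@happ_inj _ _ (restr h L) (tens M N)) => y.
rewrite raddf_sum [LHS](@happ_sum _ _ (restr h L)).
rewrite -[in RHS](coord_sum_fin y) linear_sum.
by apply: eq_bigr => j _; rewrite linearZ; apply: nu_expand.
Qed.
End RankOne.

(** * Smallness and the three isomorphism cases *)

Lemma small_hom_fin (G : zmodType) (R : gring G) (L : gmod R) (J : choiceType)
    (T : J -> gmod R) (f : gmor L (gdsum T)) : small L ->
  finite_set [set j | exists y, (f y : dsum (fun j => T j)) j != 0].
Proof.
(* Smallness makes [f] the canonical image of a finitely supported family [k f]; outside its support
   the component of [f] is zero. *)
move=> /(_ J T) [k _ kK]; rewrite -(kK f).
apply: sub_finite_set (dsum_fin (k f)) => j [y /=]; apply: contraNneq => kj.
by apply/eqP; rewrite -[LHS]/(k f j y) kj.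
Qed.

Theorem mainTheorem10 (G : zmodType) (R S : gring G) (h : gringmor R S)
    (L : gmod S) (M N : gmod R) :
  (projective N -> is_mono (nu h L M N)) /\
  ((projective (restr h L) /\ finite_type (restr h L)) \/
   (projective N /\ finite_type N) \/
   (small (restr h L) /\ projective N) ->
   is_iso (nu h L M N)).
Proof.
have iso (J : choiceType) (d : J -> G) (b : J -> N) phi
    (bP : dual_basis d b phi) :
    (forall g w, gcomp g w -> finite_set [set j | exists y : restr h L,
       contract phi j (happ (w : homS h L (tens M N)) y) != 0]) ->
    is_iso (nu h L M N).
  move=> fin; apply: bij_is_iso => [|w]; first exact: (nu_inj bP).
  (* The image of [nu] is closed under addition, so homogeneous [w] suffice. *)
  elim/(grading_ind (gmod_grading (homS h L (tens M N)))): w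
    => [|u v [t <-] [t' <-]|g w gw].
  - by exists 0; apply: raddf0.
  - by exists (t + t'); apply: raddfD.
  exact: (nu_surj_homog bP gw (fin g w gw)).
split=> [Np|[[Lp Lf]|[[Np Nf]|[Ls Np]]]].
- have [J [d [b [phi bP]]]] := projective_has_dual_basis Np.
  exact/inj_is_mono/(nu_inj bP).
- have [J [d [b [phi bP]]]] := finite_type_dual_basis Lp Lf.
  exact: nu_iso_fin_source bP.
- have [J [d [b [phi bP]]]] := finite_type_dual_basis Np Nf.
  by apply: (iso _ _ _ _ bP) => g w _; apply: finite_finset.
have [J [d [b [phi bP]]]] := projective_has_dual_basis Np.
apply: (iso _ _ _ _ bP) => g w gw.
(* The shift by [g - d j] absorbs the degree of the contraction of [w], so that the contractions
   become degree-preserving maps. *)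
pose T j := shift M (g - d j).
(* At each single [y] almost all contractions vanish, so they form a map into the direct sum;
   smallness then makes the finiteness uniform in [y]. *)
have c_fin y : ((fun j => contract phi j (happ w y)) : dprod (fun j => T j))
    \in finsupp (N := fun j => T j).
  apply/asboolP; exact: (contract_fin bP).
have cl : linear (fun y : restr h L => DSum (c_fin y) : gdsum T).
  move=> r x y; apply: dsumP => j.
  rewrite -[LHS]/(contract phi j (happ w (r *: x + y))) linearP raddfD.
  by congr (_ + _); apply: contractZ.
have cd k y : gcomp k y -> gcomp k (DSum (c_fin y) : gdsum T).
  move=> ky j.
  rewrite -[gcomp _ _]/(gcomp (g - d j + k) (contract phi j (happ w y))).
  by rewrite addrAC; apply: (contract_deg bP); apply: (hom_comp_deg gw).
exact: (small_hom_fin (mkgmor cl cd) Ls).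
Qed.
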